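(* Suppose that $H'(\mu^1)>1$. Let $\delta$ denote the probability measure on $\{0,1\}$ with mean $\mu^1$, and let $\varsigma$ be the law of $C_\emptyset$, where $C$ is the unique endogenous solution of the RDE. Then $$B(\varsigma)=\Big\{\nu\in\mathcal P:\ \int x\,d\nu(x)=\mu^1\ \text{ and }\ \nu\ne\delta\Big\}.$$
   Context: $N$ is a random variable with values in $\{1,2,\dots\}\cup\{\infty\}$, and $H(s)=\mathbb E[s^N]$ for $s\in[0,1]$, with conventions $s^\infty=0$ for $0\le s<1$ and $1^\infty=1$; in particular $H(0)=0$. Standing assumption: $H$ is strictly convex (on $[0,1)$), i.e. $\mathbb P(2\le N<\infty)>0$. $\mu^1$ is the unique root in $(0,1)$ of $H(x)+x=1$. $\mathcal P$ is the set of probability measures on $[0,1]$. The map $\mathcal T:\mathcal P\to\mathcal P$ sends $\nu$ to the law of $1-\prod_{i=1}^N X_i$, where $X_1,X_2,\dots$ are i.i.d. with law $\nu$ and independent of $N$ (an infinite product is the limit of its partial products). For a fixed point $\pi$ of $\mathcal T$, the basin of attraction is $B(\pi)=\{\nu\in\mathcal P:\mathcal T^n(\nu)\to\pi\text{ weakly as }n\to\infty\}$. $\mathbf T=\bigcup_{n\ge0}\mathbb N^n$ is the tree of finite sequences of positive integers, $\emptyset$ its root, $|u|$ the length of $u$, and $u1,u2,\dots$ the daughters of $u$; $(N_u;u\in\mathbf T)$ are i.i.d. copies of $N$. A tree-indexed solution to the RDE is a family $(X_u;u\in\mathbf T)$ of $[0,1]$-valued random variables such that (i) for every $n$ the $(X_u;|u|=n)$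 are mutually independent and independent of $(N_v;|v|\le n-1)$; (ii) for every $u$, $X_u=1-\prod_{i=1}^{N_u}X_{ui}$, and all the $X_u$ have the same law. It is endogenous if it is measurable with respect to (the completion of) $\sigma(N_u;u\in\mathbf T)$. There is an (a.s.) unique endogenous solution $C=(C_u;u\in\mathbf T)$; it is given by $C_u=\mathbb P(S_u=1\mid N_v;v\in\mathbf T)$, where $S$ is the tree-indexed solution with values in $\{0,1\}$ and $\mathbb P(S_u=1)=\mu^1$. *)

(* Defs.v *)
From HB Require Import structures.
From mathcomp Require Import all_boot all_order all_algebra finmap.
From mathcomp Require Import all_classical all_reals all_analysis.

Set Implicit Arguments.
Unset Strict Implicit.
Unset Printing Implicit Defensive.

Import Order.TTheory GRing.Theory Num.Theory.
Import numFieldNormedType.Exports.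

Local Open Scope classical_set_scope.
Local Open Scope ring_scope.

(* Values of N: [Some k] is the integer k and [None] is infinity.  The value
   [Some 0] is excluded in the statement. *)
Definition enat : Type := option nat.

HB.instance Definition _ := Pointed.on enat.
HB.instance Definition _ := @isMeasurable.Build default_measure_display
  enat discrete_measurable discrete_measurable0
  discrete_measurableC discrete_measurableU.

Section Conventions.
Context {R : realType}.

(* s^n for s in [0, 1], with s^oo = 0 for s < 1 and 1^oo = 1. *)
Definition epow (s : R) (n : enat) : R :=
  if n is Some k then s ^+ k else (s == 1)%:R.

Definition eprod (n : enat) (x : nat -> R) : R :=
  if n is Some k then \prod_(i < k) x i else limn (fun k => \prod_(i < k) x i).

Definition strictly_convex_on (D : set R) (f : R -> R) : Prop :=
  forall x y t, D x -> D y -> x != y -> 0 < t < 1 ->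
    f (t * x + (1 - t) * y) < t * f x + (1 - t) * f y.

(* Measures of the library also take (meaningless) values on non-measurable
   sets, so equality of laws is equality on measurable sets. *)
Definition eq_law d (T : measurableType d) (mu nu : set T -> \bar R) : Prop :=
  forall A, measurable A -> mu A = nu A.

End Conventions.

Section Independence.
Context d (Omega : measurableType d) (R : realType) (P : probability Omega R).

Definition mutually_independent (I : choiceType) (D : set I)
    (F : I -> set_system Omega) : Prop :=
  forall J : {fset I}, [set` J] `<=` D ->
  forall E : I -> set Omega, (forall i, i \in J -> F i (E i)) ->
    P (\bigcap_(i in [set` J]) E i) = (\prod_(i <- J) P (E i))%E.

Definition independent2 (F G : set_system Omega) : Prop :=
  forall A B, F A -> G B -> P (A `&` B) = (P A * P B)%E.

Definition sigma_of d' (T' : measurableType d') (X : Omega -> T') :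
  set_system Omega := preimage_set_system setT X measurable.

Definition sigma_family (I : Type) (D : set I) d' (T' : measurableType d')
    (X : I -> Omega -> T') : set_system Omega :=
  <<s \bigcup_(i in D) sigma_of (X i) >>.

Definition completion (G : set_system Omega) : set_system Omega :=
  [set A `|` Z | A in G
               & Z in [set Z | exists M, [/\ G M, P M = 0%E & Z `<=` M]]].

Definition pgf (N : {RV P >-> enat}) (s : R) : R :=
  \int[P]_w epow s (N w).

End Independence.

Section Map.
Context {R : realType}.

(* A probability measure on [0, 1] is a Borel probability measure on R that
   gives full mass to [0, 1]. *)
Definition prob01 : set (probability R R) :=
  [set nu : probability R R | nu `[0, 1]%classic = 1%E].

Definition mean01 (nu : probability R R) : R := \int[nu]_(x in `[0, 1]) x.

Definition weak_cvg01 (nu_ : nat -> probability R R) (pi : probability R R) :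
    Prop :=
  forall f : R -> R, {within `[0, 1], continuous f} ->
    (fun n => \int[nu_ n]_(x in `[0, 1]) f x) @ \oo
      --> \int[pi]_(x in `[0, 1]) f x.

Context d0 (Omega0 : measurableType d0) (P0 : probability Omega0 R).
Variable N : {RV P0 >-> enat}.

(* nu' is the law of 1 - \prod_(i = 1)^N X_i, where the X_i are i.i.d. with law
   nu and independent of N; the index i of the code is the index i + 1 of the
   formula. *)
Definition rde_law (nu nu' : probability R R) : Prop :=
  exists d (Omega : measurableType d) (P : probability Omega R)
    (N' : {RV P >-> enat}) (X : nat -> {RV P >-> R}),
  [/\ eq_law (distribution P N') (distribution P0 N),
      forall i w, 0 <= X i w <= 1,
      forall i, eq_law (distribution P (X i)) nu,
      mutually_independent P setT (fun i => sigma_of (X i)) /\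
      independent2 P (sigma_family setT (fun i => X i : Omega -> R))
        (sigma_of N') &
      eq_law nu'
        (pushforward P (fun w => 1 - eprod (N' w) (fun i => X i w)))].

(* Such a law exists and is unique as soon as nu is in prob01, so the default
   value of [xget] is irrelevant there. *)
Definition rde_map (nu : probability R R) : probability R R :=
  xget nu [set nu' | rde_law nu nu'].

Definition basin (pi : probability R R) : set (probability R R) :=
  [set nu | prob01 nu /\ weak_cvg01 (fun n => iter n rde_map nu) pi].

End Map.

(* The vertices of the tree are the finite sequences of naturals; the letter i
   stands for the positive integer i + 1, and the daughters of u are the
   [rcons u i]. *)
Definition vertex : choiceType := seq nat.

Section Tree.
Context d (Omega : measurableType d) (R : realType) (P : probability Omega R).
Variable N : vertex -> {RV P >-> enat}.

Definition iid_copies d0 (Omega0 : measurableType d0)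
    (P0 : probability Omega0 R) (N0 : {RV P0 >-> enat}) : Prop :=
  (forall u, eq_law (distribution P (N u)) (distribution P0 N0)) /\
  mutually_independent P setT (fun u => sigma_of (N u)).

Definition tree_solution (X : vertex -> {RV P >-> R}) : Prop :=
  [/\ forall u w, 0 <= X u w <= 1,
      forall n : nat,
        mutually_independent P [set u : vertex | size u = n]
          (fun u => sigma_of (X u)) /\
        independent2 P
          (sigma_family [set u | size u = n] (fun u => X u : Omega -> R))
          (sigma_family [set v | (size v < n)%N]
             (fun v => N v : Omega -> enat)),
      forall u, {ae P, forall w,
        X u w = 1 - eprod (N u w) (fun i => X (rcons u i) w)} &
      forall u v, eq_law (distribution P (X u)) (distribution P (X v))].

Definition endogenous (X : vertex -> {RV P >-> R}) : Prop :=
  forall u (A : set R), measurable A ->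
    completion P (sigma_family setT (fun v => N v : Omega -> enat))
      (X u @^-1` A).

End Tree.

(* Main.v *)
Require Import Defs.
From HB Require Import structures.
From mathcomp Require Import all_boot all_order all_algebra finmap.
From mathcomp Require Import all_classical all_reals all_analysis.
From mathcomp Require Import measurable_realfun.
From mathcomp Require Import ring lra.

Set Implicit Arguments.
Unset Strict Implicit.
Unset Printing Implicit Defensive.

Import Order.TTheory GRing.Theory Num.Theory.
Import numFieldNormedType.Exports.

Local Open Scope classical_set_scope.
Local Open Scope ring_scope.

(* Expanding E[(1 - prod X_i)^k] shows that the moments of T(nu) are obtained from
   those of nu by a triangular recursion in which only the generating function H
   enters.  Along the iterates of T the first moment obeys m -> 1 - H(m), for
   which mu1 is repelling since H'(mu1) > 1: it converges to mu1 only if it starts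
   there.  If so, the second moment obeys r -> 2 mu1 - 1 + H(r), a convex map with
   fixed points mu1, attained only by delta, and c < mu1, which attracts
   [0, mu1[.  Moments of order at least 2 are at most the second one, and H is a
   strict contraction on a neighbourhood [0, y] of [0, c]; by induction on the
   order all the moments converge to those of the fixed point with second moment
   c, and the Weierstrass theorem turns this into weak convergence.

   It remains to see that the second moment of the endogenous solution is not
   mu1, i.e. that it does not take its values in {0, 1}.  If it did, it would be
   the indicator of an event that can be approximated by events A depending on
   finitely many generations.  On such an A the root has the same expectation as
   the variable computed from the constant mu1 at generation n, whose second
   moment stays below some b < mu1, and the inequality of arithmetic and geometric
   means gives a contradiction. *)

(** * Expectations of bounded random variables *)

(** Three obstacles shape the proof. The map [rde_map] chooses a law satisfying [rde_law], and its
    value is meaningless unless such a law exists. So an i.i.d. sequence with law nu, independent of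
    N, has to be constructed; the binary digits of one uniform variable provide infinitely many.
    Next, H jumps at 1 if N is infinite with positive probability, and near mu1 it is expanding. The
    moments of order 0 and 1, equal to 1 and mu1, are therefore kept exactly constant along the
    iteration, and only those of order at least 2, which end up in [0, y] with y < mu1, are
    submitted to the contraction. Finally, the projection of the root on finitely many generations
    is never formed as a conditional expectation: it is tested against events of these generations
    while the tree is opened vertex by vertex. Opening a vertex turns one factor into a product over
    its daughters, so the induction statements have to concern products over several vertices of one
    generation. *)

Section BoundedMeasurable.
Context d (T : measurableType d) (R : realType).
Implicit Types f g : T -> R.

(** A class closed under ring operations and integrable under every probability measure, so that
    linearity of [mean] needs no separate integrability argument. *)
Definition bounded_measurable f :=
  measurable_fun setT f /\ exists M, forall w, `|f w| <= M.

Lemma bounded_measurable01 f : measurable_fun setT f ->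
  (forall w, 0 <= f w <= 1) -> bounded_measurable f.
Proof.
move=> mf f01; split=> //; exists 1 => w; rewrite ger0_norm.
  by have /andP[] := f01 w.
by have /andP[] := f01 w.
Qed.

Lemma bounded_measurable_cst (c : R) : bounded_measurable (fun=> c).
Proof. by split; [exact: measurable_cst|exists `|c|]. Qed.

Lemma bounded_measurableD f g : bounded_measurable f -> bounded_measurable g ->
  bounded_measurable (fun w => f w + g w).
Proof.
move=> [mf [M fM]] [mg [M' gM]]; split; first exact: measurable_funD.
by exists (M + M') => w; rewrite (le_trans (ler_normD _ _))// lerD.
Qed.

Lemma bounded_measurableM f g : bounded_measurable f -> bounded_measurable g ->
  bounded_measurable (fun w => f w * g w).
Proof.
move=> [mf [M fM]] [mg [M' gM]]; split; first exact: measurable_funM.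
by exists (M * M') => w; rewrite normrM ler_pM.
Qed.

Lemma bounded_measurableZ c f : bounded_measurable f ->
  bounded_measurable (fun w => c * f w).
Proof. by apply: bounded_measurableM; exact: bounded_measurable_cst. Qed.

Lemma bounded_measurableB f g : bounded_measurable f -> bounded_measurable g ->
  bounded_measurable (fun w => f w - g w).
Proof.
move=> bf bg; have := bounded_measurableD bf (bounded_measurableZ (-1) bg).
by under eq_fun do rewrite mulN1r.
Qed.

Lemma bounded_measurableX f n : bounded_measurable f ->
  bounded_measurable (fun w => f w ^+ n).
Proof.
move=> bf; elim: n => [|n IH]; first by under eq_fun do rewrite expr0;
  exact: bounded_measurable_cst.
by under eq_fun do rewrite exprS; exact: bounded_measurableM.
Qed.

Lemma bounded_measurable_sum (I : Type) (s : seq I) (F : I -> T -> R) :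
  (forall i, bounded_measurable (F i)) ->
  bounded_measurable (fun w => \sum_(i <- s) F i w).
Proof.
move=> bF; elim: s => [|i s IH].
  by under eq_fun do rewrite big_nil; exact: bounded_measurable_cst.
by under eq_fun do rewrite big_cons; exact: bounded_measurableD.
Qed.

Lemma bounded_measurable_prod (I : Type) (s : seq I) (F : I -> T -> R) :
  (forall i, bounded_measurable (F i)) ->
  bounded_measurable (fun w => \prod_(i <- s) F i w).
Proof.
move=> bF; elim: s => [|i s IH].
  by under eq_fun do rewrite big_nil; exact: bounded_measurable_cst.
by under eq_fun do rewrite big_cons; exact: bounded_measurableM.
Qed.

Lemma bounded_measurable_indic (A : set T) : measurable A ->
  bounded_measurable (\1_A : T -> R).
Proof.
move=> mA; apply: bounded_measurable01; first exact: measurable_indic.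
by move=> w; rewrite indicE; case: (_ \in _); rewrite lexx ler01.
Qed.

End BoundedMeasurable.

Lemma indic01 (T : Type) (R : realType) (A : set T) w : 0 <= (\1_A w : R) <= 1.
Proof. by rewrite indicE; case: (_ \in _); rewrite lexx ler01. Qed.

#[local] Hint Resolve bounded_measurable_cst bounded_measurable_indic : core.

Definition mean d (T : measurableType d) (R : realType)
  (P : probability T R) (f : T -> R) : R := \int[P]_w f w.

Section Mean.
Context d (T : measurableType d) (R : realType) (P : probability T R).
Implicit Types f g : T -> R.
Local Notation E := (mean P).

Lemma bounded_measurable_integrable f : bounded_measurable f ->
  P.-integrable setT (EFin \o f).
Proof.
move=> [mf [M fM]]; apply: measurable_bounded_integrable => //.
  by rewrite (le_lt_trans (probability_le1 _ _))// ltry.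
by exists M; split; [exact: num_real|move=> x Mx y _ /=; rewrite (le_trans (fM y))// ltW].
Qed.

Lemma eq_mean f g : (forall w, f w = g w) -> E f = E g.
Proof. by move=> /funext ->. Qed.

Lemma mean_cst c : E (fun=> c) = c.
Proof. by rewrite /mean Rintegral_cst//= (probability_setT P) mulr1. Qed.

Lemma meanD f g : bounded_measurable f -> bounded_measurable g ->
  E (fun w => f w + g w) = E f + E g.
Proof. by move=> bf bg; apply: RintegralD => //; exact: bounded_measurable_integrable. Qed.

Lemma meanB f g : bounded_measurable f -> bounded_measurable g ->
  E (fun w => f w - g w) = E f - E g.
Proof. by move=> bf bg; apply: RintegralB => //; exact: bounded_measurable_integrable. Qed.

Lemma meanZ c f : bounded_measurable f -> E (fun w => c * f w) = c * E f.
Proof. by move=> bf; apply: RintegralZl => //; exact: bounded_measurable_integrable. Qed.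

Lemma mean_sum (I : Type) (s : seq I) (F : I -> T -> R) :
  (forall i, bounded_measurable (F i)) ->
  E (fun w => \sum_(i <- s) F i w) = \sum_(i <- s) E (F i).
Proof.
move=> bF; elim: s => [|i s IH].
  by under eq_mean do rewrite big_nil; rewrite mean_cst big_nil.
under eq_mean do rewrite big_cons.
by rewrite meanD// ?IH ?big_cons//; exact: bounded_measurable_sum.
Qed.

Lemma le_mean f g : bounded_measurable f -> bounded_measurable g ->
  (forall w, f w <= g w) -> E f <= E g.
Proof.
by move=> bf bg fg; apply: le_Rintegral => //; exact: bounded_measurable_integrable.
Qed.

Lemma mean_ge0 f : (forall w, 0 <= f w) -> 0 <= E f.
Proof. by move=> f0; apply: Rintegral_ge0. Qed.

Lemma mean_le1 f : bounded_measurable f -> (forall w, f w <= 1) -> E f <= 1.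
Proof. by move=> bf f1; rewrite -[leRHS](mean_cst 1); apply: le_mean. Qed.

Lemma mean01P f : measurable_fun setT f -> (forall w, 0 <= f w <= 1) ->
  0 <= E f <= 1.
Proof.
move=> mf f01; rewrite mean_ge0 ?mean_le1//=; first exact: bounded_measurable01.
  by move=> w; case/andP: (f01 w).
by move=> w; case/andP: (f01 w).
Qed.

Lemma mean_norm_le f g e : bounded_measurable f -> bounded_measurable g ->
  (forall w, `|f w - g w| <= e) -> `|E f - E g| <= e.
Proof.
move=> bf bg fg; rewrite -meanB// ler_norml; apply/andP; split.
- rewrite -[leLHS]mean_cst; apply: le_mean => //; first exact: bounded_measurableB.
  by move=> w; have := fg w; rewrite ler_norml => /andP[].
- rewrite -[leRHS]mean_cst; apply: le_mean => //; first exact: bounded_measurableB.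
  by move=> w; have := fg w; rewrite ler_norml => /andP[].
Qed.

Lemma mean_indic A : measurable A -> (E \1_A)%:E = P A.
Proof.
move=> mA; rewrite /mean /Rintegral integral_indic// setIT fineK//.
exact: fin_num_measure.
Qed.

Lemma mean_indicE A : measurable A -> E \1_A = fine (P A).
Proof. by move=> mA; rewrite -mean_indic. Qed.

Lemma ae_eq_mean f g : measurable_fun setT f -> measurable_fun setT g ->
  {ae P, forall w, f w = g w} -> E f = E g.
Proof.
move=> mf mg fg; congr fine; apply: ae_eq_integral => //.
- exact/measurable_EFinP.
- exact/measurable_EFinP.
- by apply: filterS fg => w /= ->.
Qed.

Lemma mean_cvg (f_ : nat -> T -> R) f (M : R) :
  (forall n, measurable_fun setT (f_ n)) -> measurable_fun setT f ->
  (forall n w, `|f_ n w| <= M) ->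
  (forall w, f_ n w @[n --> \oo] --> f w) -> E (f_ n) @[n --> \oo] --> E f.
Proof.
move=> mf_ mf f_M ff; apply: fine_cvg => /=.
have bf : bounded_measurable f.
  split=> //; exists M => w; rewrite -(cvg_lim _ (cvg_norm (ff w)))//.
  apply: limr_le; last exact: nearW.
  by apply/cvg_ex; eexists; apply: cvg_norm; exact: ff.
rewrite fineK; last first.
  exact/integrable_fin_num/(bounded_measurable_integrable bf).
have [] // := @dominated_convergence _ _ _ P setT measurableT
  (fun n w => (f_ n w)%:E) (EFin \o f) (fun=> M%:E).
- by move=> n; exact/measurable_EFinP.
- exact/measurable_EFinP.
- by apply: nearW => w _; apply: cvg_EFin; [exact: nearW|exact: ff].
- exact: (@bounded_measurable_integrable (fun=> M)).
- by apply: nearW => w n _ /=; rewrite lee_fin.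
Qed.

End Mean.

Lemma eq_mean_measure d (T : measurableType d) (R : realType)
    (P Q : probability T R) f : eq_law P Q -> mean P f = mean Q f.
Proof.
by move=> PQ; congr fine; apply: eq_measure_integral => A mA _; exact: PQ.
Qed.

Lemma mean_pushforward d d' (T : measurableType d) (U : measurableType d')
    (R : realType) (P : probability T R) (X : {mfun T >-> U}) (f : U -> R) :
  bounded_measurable f -> mean (distribution P X) f = mean P (f \o X).
Proof.
move=> bf; congr fine; rewrite integral_distribution//.
- by case: bf => mf _; exact/measurable_EFinP.
- apply: (@bounded_measurable_integrable _ _ _ P (f \o X)).
  case: bf => mf [M fM]; split; last by exists M => w; exact: fM.
  exact: (measurableT_comp mf (measurable_funPT X)).
Qed.
(** * Products over an extended number of factors *)

Section ExtendedProduct.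
Context {R : realType}.
Implicit Types (x : nat -> R) (e : enat).

Lemma prod01 (I : Type) (s : seq I) (x : I -> R) :
  (forall i, 0 <= x i <= 1) -> 0 <= \prod_(i <- s) x i <= 1.
Proof.
move=> x01; elim: s => [|i s /andP[IH0 IH1]]; first by rewrite big_nil ler01 lexx.
by rewrite big_cons; have /andP[? ?] := x01 i; rewrite mulr_ge0// mulr_ile1.
Qed.

Lemma prod_ord01 n x : (forall i, 0 <= x i <= 1) -> 0 <= \prod_(i < n) x i <= 1.
Proof. by move=> x01; apply: prod01 => i; exact: x01. Qed.

Lemma is_cvg_prod01 x : (forall i, 0 <= x i <= 1) ->
  cvgn (fun k => \prod_(i < k) x i).
Proof.
move=> x01; apply: nonincreasing_is_cvgn.
  apply/nonincreasing_seqP => n; rewrite big_ord_recr/=.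
  have /andP[? ?] := x01 n; have /andP[? ?] := prod_ord01 n x01.
  exact: ler_piMr.
exists 0 => _ [n _ <-].
by have /andP[] := prod_ord01 n x01.
Qed.

Lemma eprod01 e x : (forall i, 0 <= x i <= 1) -> 0 <= eprod e x <= 1.
Proof.
move=> x01; have pr n : 0 <= \prod_(i < n) x i <= 1 by exact: prod_ord01.
case: e => [k|] /=; first exact: pr.
have cx := is_cvg_prod01 x01; apply/andP; split.
  by apply: limr_ge => //; apply: nearW => n; case/andP: (pr n).
by apply: limr_le => //; apply: nearW => n; case/andP: (pr n).
Qed.

Lemma eprod_cst (c : R) e : 0 <= c <= 1 -> eprod e (fun=> c) = epow c e.
Proof.
move=> /andP[c0 c1]; case: e => [k|] /=; first by rewrite prodr_const card_ord.
under eq_fun do rewrite prodr_const card_ord.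
have [->|cn1] := eqVneq c 1.
  by under eq_fun do rewrite expr1n; rewrite lim_cst.
by apply/cvg_lim => //; apply: cvg_expr; rewrite ger0_norm// lt_neqAle cn1.
Qed.

(** Through this identity the j-th moment of the product becomes H evaluated at the j-th moment of
    one factor. *)
Lemma eprodX e x j : (forall i, 0 <= x i <= 1) ->
  eprod e (fun i => x i ^+ j) = eprod e x ^+ j.
Proof.
move=> x01; case: e => [k|] /=; first by rewrite prodrXl.
under eq_fun do rewrite prodrXl.
elim: j => [|j IH]; first by under eq_fun do rewrite expr0; rewrite lim_cst.
have xj01 i : 0 <= x i ^+ j <= 1.
  by have /andP[? ?] := x01 i; rewrite exprn_ge0// exprn_ile1.
have cj : cvgn (fun n => (\prod_(i < n) x i) ^+ j).
  by under eq_fun do rewrite -prodrXl; exact: (@is_cvg_prod01 (fun i => x i ^+ j)).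
under eq_fun do rewrite exprS; rewrite exprS -IH.
by apply/cvg_lim => //; apply: cvgM => //; exact: is_cvg_prod01.
Qed.

(* Cuts off the values [n, oo[ of [e] and replaces the infinite product by its
   [n]-th partial product, so that it only involves finitely many factors. *)
Definition etrunc n e x : R :=
  if e is Some k then (if (k < n)%N then \prod_(i < k) x i else 0)
  else \prod_(i < n) x i.

Lemma etrunc01 n e x : (forall i, 0 <= x i <= 1) -> 0 <= etrunc n e x <= 1.
Proof.
move=> x01; have pr k : 0 <= \prod_(i < k) x i <= 1 by exact: prod_ord01.
case: e => [k|] /=; last exact: pr.
by case: ifP => _; [exact: pr|rewrite lexx ler01].
Qed.

Lemma etrunc_cvg e x : (forall i, 0 <= x i <= 1) ->
  etrunc n e x @[n --> \oo] --> eprod e x.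
Proof.
move=> x01; case: e => [k|]; last exact: is_cvg_prod01.
apply: cvg_near_cst; exists k.+1 => // n /= kn.
by rewrite kn.
Qed.

Context d (T : measurableType d).

(** Separating the values of N leaves events of N times finitely many factors, the form to which
    independence applies. *)
Lemma etruncE n (N : T -> enat) (Y : nat -> T -> R) w :
  etrunc n (N w) (Y^~ w) =
  \sum_(k < n) \1_(N @^-1` [set Some (k : nat)]) w * \prod_(i < k) Y i w +
  \1_(N @^-1` [set None]) w * \prod_(i < n) Y i w.
Proof.
have ind (e : enat) : \1_(N @^-1` [set e]) w = (N w == e)%:R :> R.
  by rewrite indicE; have [h|h] := eqVneq (N w) e;
    [rewrite mem_set|rewrite memNset//; exact/eqP].
rewrite ind; under eq_bigr do rewrite ind.
case: (N w) => [k|] /=; last first.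
  by rewrite mul1r [X in X + _]big1 ?add0r// => i _; rewrite mul0r.
rewrite mul0r addr0; case: ifPn => [kn|]; last first.
  rewrite -leqNgt => nk; rewrite big1// => i _.
  rewrite (_ : (_ == _) = false) ?mul0r//; apply/eqP => -[ki].
  by move: (ltn_ord i); rewrite -ki ltnNge nk.
rewrite (bigD1 (Ordinal kn))//= eqxx mul1r [X in _ + X]big1 ?addr0// => i ik.
by rewrite (_ : (_ == _) = false) ?mul0r//; apply/eqP => -[ki]; move/eqP: ik; apply; apply/val_inj.
Qed.

Variables (N : T -> enat) (Y : nat -> T -> R).
Hypotheses (mN : measurable_fun setT N) (mY : forall i, measurable_fun setT (Y i))
  (Y01 : forall i w, 0 <= Y i w <= 1).

Lemma measurable_value (e : enat) : measurable (N @^-1` [set e]).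
Proof. by rewrite -[X in measurable X]setTI; exact: mN. Qed.

Lemma measurable_etrunc n : measurable_fun setT (fun w => etrunc n (N w) (Y^~ w)).
Proof.
have mP k : measurable_fun setT (fun w => \prod_(i < k) Y i w).
  by apply: (bounded_measurable_prod _ _).1 => i; exact: bounded_measurable01.
under eq_fun do rewrite etruncE; apply: measurable_funD.
  apply: measurable_sum => k; apply: measurable_funM => //.
  by apply: measurable_indic; exact: measurable_value.
by apply: measurable_funM => //; apply: measurable_indic; exact: measurable_value.
Qed.

Lemma measurable_eprod : measurable_fun setT (fun w => eprod (N w) (Y^~ w)).
Proof.
apply: (@measurable_fun_cvg _ _ _ _ (fun n w => etrunc n (N w) (Y^~ w))).
  by move=> n; exact: measurable_etrunc.
by move=> w _; exact: etrunc_cvg.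
Qed.

Lemma mean_etrunc (P : probability T R) (Z : T -> R) n : bounded_measurable Z ->
  mean P (fun w => Z w * etrunc n (N w) (Y^~ w)) =
  \sum_(k < n) mean P (fun w => Z w *
     (\1_(N @^-1` [set Some (k : nat)]) w * \prod_(i < k) Y i w)) +
  mean P (fun w => Z w * (\1_(N @^-1` [set None]) w * \prod_(i < n) Y i w)).
Proof.
move=> bZ; have bP k : bounded_measurable (fun w => \prod_(i < k) Y i w).
  by apply: bounded_measurable_prod => i; exact: bounded_measurable01.
have bI e k : bounded_measurable
    (fun w => Z w * (\1_(N @^-1` [set e]) w * \prod_(i < k) Y i w)).
  apply: bounded_measurableM => //; apply: bounded_measurableM => //.
  by apply: bounded_measurable_indic; exact: measurable_value.
under eq_mean do rewrite etruncE mulrDr mulr_sumr.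
by rewrite meanD// ?mean_sum//; exact: bounded_measurable_sum.
Qed.

Lemma mean_etrunc_cvg (P : probability T R) (Z : T -> R) : bounded_measurable Z ->
  mean P (fun w => Z w * etrunc n (N w) (Y^~ w)) @[n --> \oo]
  --> mean P (fun w => Z w * eprod (N w) (Y^~ w)).
Proof.
move=> [mZ [M ZM]]; apply: (@mean_cvg _ _ _ _ _ _ M).
- by move=> n; apply: measurable_funM => //; exact: measurable_etrunc.
- by apply: measurable_funM => //; exact: measurable_eprod.
- move=> n w; have /andP[t0 t1] := etrunc01 n (N w) (Y01^~ w).
  by rewrite normrM (ger0_norm t0) (le_trans _ (ZM w))// ler_piMr.
- by move=> w; apply: cvgMr; exact: etrunc_cvg.
Qed.

End ExtendedProduct.

(** By linearity and dominated convergence along [etrunc], it suffices to compare the two sides on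
    each event N = e with finitely many factors. The number l is not tied to e, because e = [None]
    calls for arbitrarily many factors. *)
Lemma mean_eprod_transfer (R : realType) d (T : measurableType d)
    d' (T' : measurableType d') (P : probability T R) (P' : probability T' R)
    (N : T -> enat) (N' : T' -> enat) (Y : nat -> T -> R) (Y' : nat -> T' -> R)
    (Z : T -> R) (Z' : T' -> R) :
  measurable_fun setT N -> measurable_fun setT N' ->
  (forall i, measurable_fun setT (Y i)) -> (forall i, measurable_fun setT (Y' i)) ->
  (forall i w, 0 <= Y i w <= 1) -> (forall i w, 0 <= Y' i w <= 1) ->
  bounded_measurable Z -> bounded_measurable Z' ->
  (forall (e : enat) l,
    mean P (fun w => Z w * (\1_(N @^-1` [set e]) w * \prod_(i < l) Y i w)) =
    mean P' (fun w => Z' w * (\1_(N' @^-1` [set e]) w * \prod_(i < l) Y' i w))) ->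
  mean P (fun w => Z w * eprod (N w) (Y^~ w)) =
  mean P' (fun w => Z' w * eprod (N' w) (Y'^~ w)).
Proof.
move=> mN mN' mY mY' Y01 Y'01 bZ bZ' eqE.
have := mean_etrunc_cvg (P := P) mN mY Y01 bZ.
rewrite (_ : (fun n => _) = (fun n =>
    mean P' (fun w => Z' w * etrunc n (N' w) (Y'^~ w)))); last first.
  by apply/funext => n; rewrite !mean_etrunc// eqE; under eq_bigr do rewrite eqE.
by move=> /cvg_lim <- //; apply/cvg_lim => //; exact: mean_etrunc_cvg.
Qed.
(** * Independence *)

Section Staircase.
Context {R : realType}.
Implicit Types x y : R.

(** The sum S is the minimum of n and the integer part of y; the final alternative tells which of
    the two bounds is active. *)
Lemma staircase_bounds n y : 0 <= y ->
  let S := \sum_(j < n) ((j.+1%:R <= y)%R)%:R in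
  [/\ S <= y, S <= n%:R & (y <= S + 1) \/ n%:R <= S].
Proof.
move=> y0 /=; elim: n => [|n]; first by rewrite big_ord0; split=> //; right.
rewrite big_ord_recr/=; set S := \sum_(_ < _) _ => -[Sy Sn H].
have [ny|yn] := leP n.+1%:R y.
- rewrite -natr1 in ny *; have nS : n%:R <= S.
    by case: H => // H; rewrite -(lerD2r 1) (le_trans ny).
  split; [by rewrite (le_trans _ ny)// lerD2r|by rewrite lerD2r|].
  by right; rewrite lerD2r.
- rewrite addr0; split=> //; first by rewrite (le_trans Sn)// ler_nat.
  by left; case: H => // nS; rewrite (le_trans (ltW yn))// -natr1 lerD2r.
Qed.

(** On [0, 1] this is the integer part of (n+1) x divided by n+1, written as a sum of indicators so
    that composition with a measurable function gives a simple function. *)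
Definition staircase n x : R := n.+1%:R^-1 * \sum_(j < n.+1) ((j.+1%:R <= n.+1%:R * x)%R)%:R.

Lemma staircase_dist n x : 0 <= x <= 1 -> `|staircase n x - x| <= n.+1%:R^-1.
Proof.
move=> /andP[x0 x1]; have n0 : 0 < n.+1%:R :> R by rewrite ltr0n.
have nx0 : 0 <= n.+1%:R * x by rewrite mulr_ge0// ltW.
have nx1 : n.+1%:R * x <= n.+1%:R by rewrite ler_piMr// ltW.
have := staircase_bounds n.+1 nx0.
rewrite /staircase /=; set S := \sum_(_ < _) _ => -[Sy Sn H].
have -> : n.+1%:R^-1 * S - x = n.+1%:R^-1 * (S - n.+1%:R * x).
  by rewrite mulrBr mulKf// gt_eqF.
have ni0 : 0 <= n.+1%:R^-1 :> R by rewrite invr_ge0 ltW.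
rewrite normrM (ger0_norm ni0); apply: ler_piMr => //.
rewrite distrC ger0_norm ?subr_ge0// lerBlDl.
by case: H => // /(le_trans nx1) h; rewrite (le_trans h)// lerDl.
Qed.

Lemma staircase_cvg x : 0 <= x <= 1 -> staircase n x @[n --> \oo] --> x.
Proof.
move=> x01; apply/cvgrPdist_lt => e e0; near=> n.
rewrite distrC (le_lt_trans (staircase_dist n x01))//.
by near: n; exact: near_infty_natSinv_lt (PosNum e0).
Unshelve. all: end_near. Qed.

End Staircase.

(* Independence with all the events [X \in B] extends to functions of [X], by
   uniform approximation with combinations of indicators. *)
Lemma mean_mul_comp (R : realType) d d' (T : measurableType d)
    (U : measurableType d') (P : probability T R) (Z : T -> R) (X : T -> U)
    (f : U -> R) :
  bounded_measurable Z -> measurable_fun setT X -> measurable_fun setT f ->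
  (forall u, 0 <= f u <= 1) ->
  (forall B, measurable B -> mean P (fun w => Z w * \1_B (X w)) =
    mean P Z * mean P (fun w => \1_B (X w))) ->
  mean P (fun w => Z w * f (X w)) = mean P Z * mean P (fun w => f (X w)).
Proof.
move=> bZ mX mf f01 ZB.
pose B n j := [set u | j.+1%:R <= n.+1%:R * f u].
have mB n j : measurable (B n j).
  rewrite -[X in measurable X]setTI; apply: (@measurable_fun_ler _ _ _ setT) => //.
  by apply: measurable_funM.
have stE n u : staircase n (f u) = \sum_(j < n.+1) n.+1%:R^-1 * \1_(B n j) u.
  rewrite /staircase mulr_sumr; apply: eq_bigr => j _; congr (_ * _).
  rewrite indicE; congr (_%:R); congr nat_of_bool.
  by apply/idP/idP; rewrite inE.
have bB n j : bounded_measurable (fun w => \1_(B n j) (X w) : R).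
  apply: bounded_measurable01 => [|w]; last exact: indic01.
  by apply: measurableT_comp => //; exact: measurable_indic.
have bst n : bounded_measurable (fun w => staircase n (f (X w))).
  under eq_fun do rewrite stE; apply: bounded_measurable_sum => j.
  exact: bounded_measurableZ.
have st n : mean P (fun w => Z w * staircase n (f (X w))) =
    mean P Z * mean P (fun w => staircase n (f (X w))).
  under eq_mean do rewrite stE mulr_sumr.
  rewrite mean_sum; last first.
    by move=> j; apply: bounded_measurableM => //; exact: bounded_measurableZ.
  under [X in _ = _ * X]eq_mean do rewrite stE.
  rewrite mean_sum; last by move=> j; exact: bounded_measurableZ.
  rewrite mulr_sumr; apply: eq_bigr => j _.
  under eq_mean do rewrite mulrCA.
  rewrite meanZ; last exact: bounded_measurableM.
  by rewrite ZB// meanZ// mulrCA.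
have st01 n w : `|staircase n (f (X w))| <= 2.
  have n1 : n.+1%:R^-1 <= 1 :> R by rewrite invf_le1// ler1n.
  have := le_trans (staircase_dist n (f01 (X w))) n1; move: (staircase _ _) => a.
  have /andP[] := f01 (X w); move: (f (X w)) => b ? ?.
  by rewrite !ler_norml => /andP[? ?]; apply/andP; split; lra.
have fc w : staircase n (f (X w)) @[n --> \oo] --> f (X w) by exact: staircase_cvg.
have mfX : measurable_fun setT (fun w => f (X w)) by exact: measurableT_comp.
have [mZ [M ZM]] := bZ.
have M0 : 0 <= M by rewrite (le_trans _ (ZM point)).
have /cvg_lim <-// : mean P (fun w => Z w * staircase n (f (X w))) @[n --> \oo]
    --> mean P (fun w => Z w * f (X w)).
  apply: (@mean_cvg _ _ _ _ _ _ (M * 2)) => //.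
  - by move=> n; apply: measurable_funM => //; case: (bst n).
  - exact: measurable_funM.
  - by move=> n w; rewrite normrM ler_pM.
  - by move=> w; apply: cvgMr; exact: fc.
apply/cvg_lim => //; under eq_fun do rewrite st; apply: cvgMr.
by apply: (@mean_cvg _ _ _ _ _ _ 2) => // n; case: (bst n).
Qed.

Section Independence.
Context d (T : measurableType d) (R : realType) (P : probability T R).
Context (I : choiceType) d' (U : measurableType d').
Implicit Types (X : I -> T -> U) (D : set I) (s : seq I).

Lemma sigma_of_measurable (Y : T -> U) A :
  measurable_fun setT Y -> sigma_of Y A -> measurable A.
Proof. by move=> mY [B mB <-]; exact: mY. Qed.

Lemma sigma_family_measurable D X A :
  (forall i, measurable_fun setT (X i)) -> sigma_family D X A -> measurable A.
Proof.
move=> mX; apply: smallest_sub; first exact: sigma_algebra_measurable.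
by move=> B [i _]; exact: sigma_of_measurable.
Qed.

Lemma sigma_family_preimage D X i B : D i -> measurable B ->
  sigma_family D X (X i @^-1` B).
Proof.
move=> Di mB; apply: sub_sigma_algebra; exists i => //.
by exists B => //; rewrite setTI.
Qed.

Lemma sigma_family_sub D D' X : D `<=` D' ->
  sigma_family D X `<=` sigma_family D' X.
Proof. by move=> DD'; apply: sub_sigma_algebra2 => A [i Di]; exists i => //; exact: DD'. Qed.

Lemma sigma_familyI D X A B : sigma_family D X A -> sigma_family D X B ->
  sigma_family D X (A `&` B).
Proof. exact: (@measurableI _ (g_sigma_algebraType _)). Qed.

Lemma sigma_familyT D X : sigma_family D X setT.
Proof. exact: (@measurableT _ (g_sigma_algebraType _)). Qed.

Lemma prod_indic s (E : I -> set U) X w :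
  \prod_(i <- s) \1_(E i) (X i w) =
  \1_(\bigcap_(i in [set` s]) (X i @^-1` E i)) w :> R.
Proof.
rewrite bigcap_seq; elim: s => [|i s IH]; first by rewrite !big_nil indicT.
by rewrite !big_cons IH indicI.
Qed.

Lemma probability_bigcap D X s (E : I -> set U) :
  mutually_independent P D (fun i => sigma_of (X i)) ->
  {subset s <= D} -> uniq s -> (forall i, measurable (E i)) ->
  P (\bigcap_(i in [set` s]) (X i @^-1` E i)) =
  (\prod_(i <- s) P (X i @^-1` E i))%E.
Proof.
move=> indX sD us mE.
have := indX [fset i in s]%fset _ (fun i => X i @^-1` E i) _.
rewrite (_ : [set` [fset i in s]%fset] = [set` s]); last first.
  by apply/seteqP; split => i /=; rewrite !inE.
move=> ->.
- apply: perm_big; apply: uniq_perm => // i.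
  by rewrite !inE.
- by move=> i /= /sD; rewrite inE.
- by move=> i _; exists (E i) => //; rewrite setTI.
Qed.

(** For indicators this is the definition of independence; the indicators are then exchanged for
    arbitrary functions one index at a time. *)
Lemma mean_prod_independent D X (G : set_system T) A s (f : I -> U -> R) :
  mutually_independent P D (fun i => sigma_of (X i)) ->
  independent2 P (sigma_family D X) G ->
  (forall i, measurable_fun setT (X i)) ->
  G A -> measurable A -> {subset s <= D} -> uniq s ->
  (forall i, measurable_fun setT (f i)) -> (forall i u, 0 <= f i u <= 1) ->
  mean P (fun w => \1_A w * \prod_(i <- s) f i (X i w)) =
  mean P \1_A * \prod_(i <- s) mean P (fun w => f i (X i w)).
Proof.
move=> indX indG mX GA mA sD us; have bA := @bounded_measurable_indic _ _ R _ mA.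
(* The list [a] holds the indices where f is already arbitrary; at the others f is still the
   indicator of [E i]. *)
suff main (a : seq I) (E : I -> set U) : (forall i, measurable (E i)) ->
    forall f : I -> U -> R, (forall i, measurable_fun setT (f i)) ->
    (forall i u, 0 <= f i u <= 1) ->
    (forall i, i \in s -> i \notin a -> f i = \1_(E i)) ->
  mean P (fun w => \1_A w * \prod_(i <- s) f i (X i w)) =
  mean P \1_A * \prod_(i <- s) mean P (fun w => f i (X i w)).
  move=> mf f01; apply: (main s (fun=> setT) _ f) => //.
  by move=> i ->.
elim: a E => [|i a IH] E mE {}f mf f01 fE.
  have {}fE i : i \in s -> f i = \1_(E i) by move=> /fE; exact.
  rewrite (_ : (fun w => _) =
      \1_(A `&` \bigcap_(i in [set` s]) (X i @^-1` E i))); last first.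
    apply/funext => w; rewrite indicI /= -prod_indic; congr (_ * _).
    by apply: eq_big_seq => i /fE ->.
  have mS : sigma_family D X (\bigcap_(i in [set` s]) (X i @^-1` E i)).
    apply: (@fin_bigcap_measurable _ (g_sigma_algebraType _)) => // i is2.
    by apply: sigma_family_preimage => //; have := sD i is2; rewrite inE.
  have mSm := sigma_family_measurable mX mS.
  apply: EFin_inj; rewrite mean_indic; last exact: measurableI.
  rewrite setIC indG// EFinM mean_indic// muleC; congr (_ * _)%E.
  rewrite (probability_bigcap indX)// -prodEFin; apply: eq_big_seq => i is2.
  rewrite (fE i is2) (_ : (fun w => _) = \1_(X i @^-1` E i)).
    by rewrite mean_indic//; have := mX i measurableT _ (mE i); rewrite setTI.
  by apply/funext => w; rewrite !indicE.
have [is_|nis] := boolP (i \in s); last first.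
  apply: (IH E) => // j js ja; apply: fE => //; rewrite inE negb_or ja andbT.
  by apply: contraNneq nis => <-.
have bf j : bounded_measurable (fun w => f j (X j w)).
  by apply: bounded_measurable01 => //; exact: measurableT_comp.
pose Z w := \prod_(j <- s | j != i) f j (X j w).
have bZ : bounded_measurable Z.
  rewrite /Z; under eq_fun do rewrite -big_filter.
  exact: bounded_measurable_prod.
(* To release the factor at i, [mean_mul_comp] asks for the identity with an indicator at i; this is
   the induction hypothesis for [f'] and [E']. *)
have hB B : measurable B ->
    mean P (fun w => (\1_A w * Z w) * \1_B (X i w)) =
    mean P \1_A * (\prod_(j <- s | j != i) mean P (fun w => f j (X j w))) *
    mean P (fun w => \1_B (X i w)).
  move=> mB.
  pose f' j := if j == i then \1_B else f j.
  pose E' j := if j == i then B else E j.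
  have f'f j : j != i -> f' j = f j by rewrite /f' => /negbTE ->.
  have f'i : f' i = \1_B by rewrite /f' eqxx.
  have prE : (\prod_(j <- s | j != i) mean P (fun w => f j (X j w))) *
      mean P (fun w => \1_B (X i w)) =
      \prod_(j <- s) mean P (fun w => f' j (X j w)).
    rewrite [RHS](bigD1_seq i)//= f'i mulrC; congr (_ * _).
    by apply: eq_bigr => j ji; rewrite f'f.
  rewrite -mulrA prE -(IH E').
  - apply: eq_mean => w; rewrite (bigD1_seq i)//= f'i -mulrA [Z w * _]mulrC.
    by congr (_ * (_ * _)); apply: eq_bigr => j ji; rewrite f'f.
  - by move=> j; rewrite /E'; case: ifP.
  - by move=> j; rewrite /f'; case: ifP => // _; exact: measurable_indic.
  - by move=> j u; rewrite /f'; case: ifP => // _; exact: indic01.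
  - move=> j js ja; rewrite /f' /E'; case: ifPn => // ji.
    by apply: fE => //; rewrite inE negb_or ji.
have Zm : mean P (fun w => \1_A w * Z w) =
    mean P \1_A * (\prod_(j <- s | j != i) mean P (fun w => f j (X j w))).
  have := hB setT measurableT; rewrite indicT.
  by under eq_mean do rewrite mulr1; rewrite mean_cst mulr1.
rewrite (bigD1_seq i)//= mulrCA -Zm mulrC -(mean_mul_comp _ (mX i) (mf i))//.
- by apply: eq_mean => w; rewrite (bigD1_seq i)//= mulrA mulrAC.
- exact: bounded_measurableM.
- by move=> B mB; rewrite hB// Zm.
Qed.

End Independence.
(** As functions of A both sides are finite measures: the restriction of P to B, and P scaled by the
    mass of B. They agree on the pi-system G, hence on the sigma-algebra it generates. *)
Lemma independent_generated d (T : measurableType d) (R : realType)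
    (P : probability T R) (G : set_system T) (B : set T) :
  G `<=` measurable -> setI_closed G -> G setT -> measurable B ->
  (forall A, G A -> P (A `&` B) = (P A * P B)%E) ->
  forall A, <<s G >> A -> P (A `&` B) = (P A * P B)%E.
Proof.
move=> Gm GI GT mB GB A sA.
have PB : (fine (P B))%:E = P B by rewrite fineK// fin_num_measure.
have PB0 : 0 <= fine (P B) by rewrite fine_ge0.
rewrite -[LHS]/(mrestr P mB A) muleC -PB -[RHS]/(mscale (NngNum PB0) P A).
apply: (g_sigma_algebra_measure_unique G Gm (fun=> setT)) => //.
- by rewrite -subTset => x _; exists 0%N.
- move=> C GC; rewrite -[LHS]/(P (C `&` B)) GB// muleC.
  by rewrite -[RHS]/((fine (P B))%:E * P C)%E PB; reflexivity.
- move=> k; rewrite -[ltLHS]/(P (setT `&` B)) setTI.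
  by rewrite (le_lt_trans (probability_le1 _ _))// ltry.
Qed.

Section SigmaFamilyIndependence.
Context d (T : measurableType d) (R : realType) (P : probability T R).
Context (I : choiceType) d' (U : measurableType d') (X : I -> T -> U).
Hypothesis mX : forall i, measurable_fun setT (X i).
Hypothesis indX : mutually_independent P setT (fun i => sigma_of (X i)).

Let cylinder (D : set I) : set_system T := [set A | exists (s : seq I) E,
  [/\ {subset s <= D}, forall i, measurable (E i) &
      A = \bigcap_(i in [set` s]) (X i @^-1` E i)]].

Let cylinderI D : setI_closed (cylinder D).
Proof.
move=> _ _ [s1 [E1 [s1D mE1 ->]]] [s2 [E2 [s2D mE2 ->]]].
(* The two index lists may overlap, so both constraints are kept at every index, with [setT] for an
   absent one. *)
exists (s1 ++ s2), (fun i => (if i \in s1 then E1 i else setT) `&`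
  (if i \in s2 then E2 i else setT)); split.
- by move=> i; rewrite mem_cat => /orP[/s1D|/s2D].
- by move=> i; apply: measurableI; case: ifP.
apply/seteqP; split => [w [h1 h2] i _|w h].
  by split; case: ifPn => //; [exact: h1|exact: h2].
split=> i /= is_.
  by have /= := h i; rewrite mem_cat is_ => /(_ isT)[].
by have /= := h i; rewrite mem_cat is_ orbT => /(_ isT)[].
Qed.

Let cylinder_sub D : sigma_family D X `<=` <<s cylinder D >>.
Proof.
apply: smallest_sub; first exact: smallest_sigma_algebra.
move=> _ [i Di [B mB <-]]; apply: sub_sigma_algebra.
exists [:: i], (fun=> B); split=> //.
  by move=> j; rewrite !inE => /eqP ->.
rewrite setTI; apply/seteqP; split => [w h j|w /(_ i)]; last first.
  by apply; rewrite /= inE.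
by rewrite /= inE => /eqP ->.
Qed.

(** Serves to integrate out N at one vertex of the tree against an event that involves other
    vertices only. *)
Lemma independent_sigma_family (D : set I) u : ~ D u ->
  independent2 P (sigma_family D X) (sigma_of (X u)).
Proof.
move=> Du A _ sA [B mB <-]; rewrite setTI.
have mXB : measurable (X u @^-1` B) by rewrite -[X in measurable X]setTI; exact: mX.
have mcyl (s : seq I) E : (forall i, measurable (E i)) ->
    measurable (\bigcap_(i in [set` s]) (X i @^-1` E i)).
  move=> mE; apply: fin_bigcap_measurable => // i _.
  by rewrite -[X in measurable X]setTI; exact: mX.
apply: (@independent_generated _ _ _ P (cylinder D)) => //; last first.
- exact: cylinder_sub.
- move=> _ [s0 [E [sD mE ->]]].
  have -> : [set` s0] = [set` undup s0] by apply/seteqP; split=> i /=; rewrite mem_undup.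
  have us : uniq (undup s0) by exact: undup_uniq.
  have {}sD : {subset undup s0 <= D} by move=> i; rewrite mem_undup; exact: sD.
  move: (undup s0) us sD => s us sD.
  have us' : u \notin s by apply/negP => /sD; rewrite inE.
  pose E' i := if i == u then B else E i.
  have mE' i : measurable (E' i) by rewrite /E'; case: ifP.
  have sT (r : seq I) : {subset r <= [set: I]} by move=> i _; rewrite inE.
  have EE' i : i \in s -> E' i = E i.
    by move=> is_; rewrite /E'; case: eqVneq => // iu; move: us'; rewrite -iu is_.
  have := probability_bigcap indX (sT (u :: s)) _ mE'.
  rewrite /= us' us => /(_ isT); rewrite big_cons {2}/E' eqxx.
  rewrite (eq_big_seq (fun i => P (X i @^-1` E i))); last by move=> i /EE' ->.
  rewrite -(probability_bigcap indX)// muleC => <-; congr (P _).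
  apply/seteqP; split => [w [h hu] i /=|w h].
    rewrite inE /E'; case: eqVneq => [->//|iu /= is_]; exact: h.
  split; last by have := h u; rewrite /= inE eqxx /E' eqxx; exact.
  move=> i /= is_; have := h i; rewrite /= inE is_ orbT EE'//; exact.
- by exists [::], (fun=> setT); split=> //; rewrite set_nil bigcap_set0.
- by move=> _ [s [E [_ mE ->]]]; exact: mcyl.
Qed.

End SigmaFamilyIndependence.

(** * Moments and the recursive tree *)

Section MomentStep.
Context {R : realType}.

Definition moment_step (H : R -> R) (m : nat -> R) (k : nat) : R :=
  \sum_(j < k.+1) ((-1) ^+ j * H (m j)) *+ 'C(k, j).

Context d (T : measurableType d) (P : probability T R).

Lemma mean_one_sub_exp (Z x : T -> R) k :
  bounded_measurable Z -> bounded_measurable x ->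
  mean P (fun w => Z w * (1 - x w) ^+ k) =
  \sum_(j < k.+1) ((-1) ^+ j * mean P (fun w => Z w * x w ^+ j)) *+ 'C(k, j).
Proof.
move=> bZ bx.
have bZx j : bounded_measurable (fun w => Z w * x w ^+ j).
  by apply: bounded_measurableM => //; exact: bounded_measurableX.
have -> : (fun w => Z w * (1 - x w) ^+ k) = (fun w =>
    \sum_(j < k.+1) ((-1) ^+ j *+ 'C(k, j)) * (Z w * x w ^+ j)).
  apply/funext => w; rewrite exprBn mulr_sumr; apply: eq_bigr => j _.
  by rewrite expr1n mulr1 mulrnAr mulrnAl mulrCA.
rewrite mean_sum; last by move=> j; exact: bounded_measurableZ.
by apply: eq_bigr => j _; rewrite meanZ// mulrnAl.
Qed.

Context d0 (T0 : measurableType d0) (P0 : probability T0 R) (N0 : {RV P0 >-> enat}).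
Variables (N : T -> enat) (Y : nat -> T -> R) (Z : T -> R) (K : R) (c : nat -> R).
Hypotheses (mN : measurable_fun setT N) (mY : forall i, measurable_fun setT (Y i))
  (Y01 : forall i w, 0 <= Y i w <= 1) (bZ : bounded_measurable Z)
  (c01 : forall j, 0 <= c j <= 1).

(** The weight Z carries whatever else is being integrated, and K plays the part of its mean: Z is 1
    when the moments of a law are computed, and an event times the factors at other vertices when
    the tree is opened at one vertex. *)
Lemma mean_rde k :
  (forall (e : enat) l j, mean P (fun w => Z w *
      (\1_(N @^-1` [set e]) w * \prod_(i < l) Y i w ^+ j)) =
    K * (mean P0 \1_(N0 @^-1` [set e]) * c j ^+ l)) ->
  mean P (fun w => Z w * (1 - eprod (N w) (Y^~ w)) ^+ k) =
  K * moment_step (pgf N0) c k.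
Proof.
move=> hZ; have be : bounded_measurable (fun w => eprod (N w) (Y^~ w)).
  apply: bounded_measurable01; first exact: measurable_eprod.
  by move=> w; exact: eprod01.
rewrite mean_one_sub_exp// /moment_step mulr_sumr; apply: eq_bigr => j _.
rewrite mulrnAr [K * _]mulrCA; congr (_ *+ _); congr (_ * _).
have Yj01 i w : 0 <= Y i w ^+ j <= 1.
  by have /andP[? ?] := Y01 i w; rewrite exprn_ge0// exprn_ile1.
under eq_mean do rewrite -eprodX//.
have -> : K * pgf N0 (c j) = mean P0 (fun w => K * eprod (N0 w) (fun=> c j)).
  have bc : bounded_measurable (fun w => eprod (N0 w) (fun=> c j)).
    apply: bounded_measurable01 => [|w]; last exact: eprod01.
    by apply: (@measurable_eprod _ _ _ N0 (fun _ _ => c j)).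
  by rewrite meanZ//; congr (_ * _); apply: eq_mean => w; rewrite eprod_cst.
apply: (@mean_eprod_transfer _ _ _ _ _ P P0 N N0 (fun i w => Y i w ^+ j)
  (fun _ _ => c j) Z (fun=> K)) => //.
- by move=> i; exact: measurable_funX.
- move=> e l; rewrite hZ.
  under [RHS]eq_mean do rewrite prodr_const card_ord [_ * c j ^+ l]mulrC mulrA.
  rewrite meanZ; last by apply: bounded_measurable_indic; exact: measurable_value.
  by rewrite -mulrA [c j ^+ l * _]mulrC.
Qed.

End MomentStep.
Lemma mean_indicI d (T : measurableType d) (R : realType) (P : probability T R)
    (A B : set T) : measurable A -> measurable B -> P (A `&` B) = (P A * P B)%E ->
  mean P \1_(A `&` B) = mean P \1_A * mean P \1_B :> R.
Proof.
move=> mA mB AB; apply: EFin_inj; rewrite EFinM !mean_indic//.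
exact: measurableI.
Qed.

Section Children.

Definition children (u : vertex) l : seq vertex := [seq rcons u i | i <- iota 0 l].

Lemma uniq_children u l (s : seq vertex) : uniq s ->
  (forall i, rcons u i \notin s) -> uniq (children u l ++ s).
Proof.
move=> us ui; rewrite cat_uniq us andbT map_inj_uniq ?iota_uniq//=; last first.
  exact: rcons_injr.
by apply/hasPn => v vs; apply/negP => /mapP[i _ vi]; move: (ui i); rewrite -vi vs.
Qed.

Lemma notin_children (u v : vertex) l (s : seq vertex) i : v != u ->
  rcons v i \notin s -> rcons v i \notin children u l ++ s.
Proof.
move=> vu vs; rewrite mem_cat negb_or vs andbT; apply/negP => /mapP[k _].
by move=> /rcons_inj[vu']; rewrite vu' eqxx in vu.
Qed.

Lemma size_children u l v : v \in children u l -> size v = (size u).+1.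
Proof. by move=> /mapP[i _ ->]; rewrite size_rcons. Qed.

Lemma prod_children (R : realType) u l (F : vertex -> R) :
  \prod_(v <- children u l) F v = \prod_(i < l) F (rcons u i).
Proof. by rewrite big_map -[RHS](big_mkord xpredT (fun i => F (rcons u i))) /index_iota subn0. Qed.

End Children.

Section Tree.
Context (R : realType) d0 (Omega0 : measurableType d0) (P0 : probability Omega0 R)
  (N0 : {RV P0 >-> enat}).
Context d (Omega : measurableType d) (P : probability Omega R)
  (N : vertex -> {RV P >-> enat}).
Hypothesis N_iid : iid_copies N N0.

Let mN u : measurable_fun setT (N u) := measurable_funPT (N u).

Let mNe u e : measurable (N u @^-1` [set e]) := measurable_value (mN u) e.

Let sigma_N D A : sigma_family D (fun v => N v : Omega -> enat) A -> measurable A.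
Proof. exact: sigma_family_measurable. Qed.

Let mean_Ne u e : mean P \1_(N u @^-1` [set e]) = mean P0 \1_(N0 @^-1` [set e]) :> R.
Proof.
apply: EFin_inj; rewrite !mean_indic//; last exact: measurable_value.
exact: (N_iid.1 u [set e]).
Qed.

Variable mu : R.
Hypothesis mu01 : 0 <= mu <= 1.

(** For a solution with mean mu this is the conditional expectation of its value at u given N in the
    generations before |u| + j, as [mean_solution_truncated] shows. *)
Fixpoint truncated (j : nat) (u : vertex) (w : Omega) : R :=
  if j is j'.+1 then 1 - eprod (N u w) (fun i => truncated j' (rcons u i) w)
  else mu.

Lemma truncated01 j u w : 0 <= truncated j u w <= 1.
Proof.
elim: j u => [//|j IH] u /=.
by have /andP[? ?] := eprod01 (N u w) (fun i => IH (rcons u i)); apply/andP; split; lra.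
Qed.

Lemma measurable_truncated j u : measurable_fun setT (truncated j u).
Proof.
elim: j u => [|j IH] u /=; first exact: measurable_cst.
apply: measurable_funB => //; apply: (measurable_eprod (mN u)).
  by move=> i; exact: IH.
by move=> i w; exact: truncated01.
Qed.

Lemma bounded_measurable_truncated j u : bounded_measurable (truncated j u).
Proof.
by apply: bounded_measurable01; [exact: measurable_truncated|exact: truncated01].
Qed.

Definition truncated_moment j : nat -> R :=
  iter j (moment_step (pgf N0)) (fun e => mu ^+ e).

(* A pair (u, e) of [S] stands for the e-th power of the variable at [u]. *)
Lemma mean_truncated j m (S : seq (vertex * nat)) A :
  (forall p, p \in S -> size p.1 = m) -> uniq (map fst S) ->
  sigma_family [set v | (size v < m)%N] (fun v => N v : Omega -> enat) A ->
  mean P (fun w => \1_A w * \prod_(p <- S) truncated j p.1 w ^+ p.2) =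
  mean P \1_A * \prod_(p <- S) truncated_moment j p.2.
Proof.
elim: j m S A => [|j IH] m S A Sm uS sA; have mA := sigma_N sA.
  under eq_mean do rewrite mulrC /=.
  by rewrite (meanZ P (\prod_(p <- S) mu ^+ p.2))// 1?mulrC//; exact: bounded_measurable_indic.
(* The alternating sums in [moment_step] do not show these bounds; they are read off the induction
   hypothesis at the root alone, where [truncated_moment] is a genuine moment. *)
have c01 e : 0 <= truncated_moment j e <= 1.
  have sT : sigma_family [set v | (size v < 0)%N] (fun v => N v : Omega -> enat) setT.
    exact: sigma_familyT.
  have := IH 0%N [:: ([::], e)] setT _ isT sT.
  rewrite big_seq1 indicT mean_cst mul1r => <-; last first.
    by move=> p; rewrite inE => /eqP ->.
  under eq_mean do rewrite big_seq1 mul1r.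
  apply: mean01P => [|w]; first exact/measurable_funX/measurable_truncated.
  by have /andP[? ?] := truncated01 j [::] w; rewrite exprn_ge0// exprn_ile1.
(* The vertices are opened one at a time: S' holds those of generation m still closed, S1 the
   daughters produced so far. B may involve N at opened vertices but not on S', where N has yet to
   be integrated out. *)
suff inner S' S1 B : (forall p, p \in S' -> size p.1 = m) -> uniq (map fst S') ->
    (forall p, p \in S1 -> size p.1 = m.+1) -> uniq (map fst S1) ->
    (forall u i, u \in map fst S' -> rcons u i \notin map fst S1) ->
    sigma_family [set v | (size v <= m)%N /\ v \notin map fst S']
      (fun v => N v : Omega -> enat) B ->
  mean P (fun w => \1_B w * ((\prod_(p <- S') truncated j.+1 p.1 w ^+ p.2) *
      \prod_(p <- S1) truncated j p.1 w ^+ p.2)) =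
  mean P \1_B * ((\prod_(p <- S') truncated_moment j.+1 p.2) *
      \prod_(p <- S1) truncated_moment j p.2).
  have := inner S [::] A Sm uS _ isT _ _.
  under eq_mean do rewrite big_nil mulr1; rewrite big_nil mulr1; apply => //.
  apply: sigma_family_sub sA => v /= vm; split; first exact: ltnW.
  by apply/negP => /mapP[p /Sm pm vp]; rewrite vp pm ltnn in vm.
elim: S' S1 B {Sm uS sA mA} => [|[u e] S' IHS] S1 B Sm uS S1m uS1 SS1 sB;
    have mB := sigma_N sB.
  rewrite big_nil mul1r -(IH m.+1)//.
    by apply: eq_mean => w; rewrite big_nil mul1r.
  by apply: sigma_family_sub sB => v [].
move: uS; rewrite /= => /andP[uS' uS].
have um : size u = m by exact: (Sm (u, e) (mem_head _ _)).
have {}Sm p : p \in S' -> size p.1 = m by move=> pS; apply: Sm; rewrite inE pS orbT.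
have btr (s : seq (vertex * nat)) i :
    bounded_measurable (fun w => \prod_(p <- s) truncated i p.1 w ^+ p.2).
  apply: bounded_measurable_prod => p; apply: bounded_measurableX.
  exact: bounded_measurable_truncated.
pose Z w := \1_B w * ((\prod_(p <- S') truncated j.+1 p.1 w ^+ p.2) *
      \prod_(p <- S1) truncated j p.1 w ^+ p.2).
have bZ : bounded_measurable Z.
  apply: bounded_measurableM; first exact: bounded_measurable_indic.
  exact: bounded_measurableM.
pose K := mean P \1_B * ((\prod_(p <- S') truncated_moment j.+1 p.2) *
      \prod_(p <- S1) truncated_moment j p.2).
transitivity (K * moment_step (pgf N0) (truncated_moment j) e); last first.
  by rewrite big_cons /K /=; ring.
rewrite -(@mean_rde _ _ _ P _ _ P0 N0 (N u) (fun i => truncated j (rcons u i)) Z)//.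
- by apply: eq_mean => w; rewrite big_cons /Z /=; ring.
- by move=> i; exact: measurable_truncated.
- by move=> i w; exact: truncated01.
move=> ev l t.
(* Once the power is expanded and N is fixed at u, the vertex u gives way to its first l daughters,
   all with exponent t, and the event on N at u joins B. *)
pose S2 := [seq (v, t) | v <- children u l] ++ S1.
have S2E : map fst S2 = children u l ++ map fst S1.
  by rewrite map_cat -map_comp map_id.
have pS2 i w : \prod_(p <- S2) truncated i p.1 w ^+ p.2 =
    (\prod_(k < l) truncated i (rcons u k) w ^+ t) *
    \prod_(p <- S1) truncated i p.1 w ^+ p.2.
  by rewrite big_cat big_map /= -(prod_children _ _ (fun v => truncated i v w ^+ t)).
transitivity (mean P \1_(B `&` (N u @^-1` [set ev])) *
    ((\prod_(p <- S') truncated_moment j.+1 p.2) *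
      \prod_(p <- S2) truncated_moment j p.2)).
  rewrite -IHS//.
  - apply: eq_mean => w; rewrite /Z pS2 indicI /=.
    by ring.
  - move=> p; rewrite mem_cat => /orP[/mapP[v vu ->]|/S1m//].
    by rewrite (size_children vu) um.
  - rewrite S2E; apply: uniq_children => // i; apply: SS1; exact: mem_head.
  - move=> v i vS; rewrite S2E; apply: notin_children.
      by apply: contraNneq uS' => <-.
    by apply: SS1; rewrite inE vS orbT.
  - apply: sigma_familyI.
      apply: sigma_family_sub sB => v [vm]; rewrite inE negb_or => /andP[_ vS].
      by split.
    by apply: sigma_family_preimage => //; split => //; rewrite um.
rewrite mean_indicI//; last first.
  apply: (independent_sigma_family _ N_iid.2 _ sB) => //.
    by move=> -[_ /negP]; apply; exact: mem_head.
  by exists [set ev] => //; rewrite setTI.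
rewrite big_cat big_map /= prod_children prodr_const card_ord mean_Ne /K.
by ring.
Qed.

End Tree.

(** * Projection of a tree solution on finitely many generations *)

Lemma mean_mul_one_sub d (T : measurableType d) (R : realType)
    (P : probability T R) (Z x : T -> R) :
  bounded_measurable Z -> bounded_measurable x ->
  mean P (fun w => Z w * (1 - x w)) = mean P Z - mean P (fun w => Z w * x w).
Proof.
move=> bZ bx; rewrite -meanB//; last exact: bounded_measurableM.
by apply: eq_mean => w; rewrite mulrBr mulr1.
Qed.

(** Extends the identity of [0, 1] to a function bounded on all of R, as [mean_prod_independent]
    requires. It is also the distribution function of the uniform law. *)
Definition clamp01 {R : realType} (x : R) : R := Num.max 0 (Num.min 1 x).

Lemma clamp01_01 (R : realType) (x : R) : 0 <= clamp01 x <= 1.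
Proof. by rewrite /clamp01 le_max lexx /= ge_max ler01 ge_min lexx. Qed.

Lemma clamp01_id (R : realType) (x : R) : 0 <= x <= 1 -> clamp01 x = x.
Proof. by move=> /andP[? ?]; rewrite /clamp01 min_r// max_r. Qed.

Lemma measurable_clamp01 (R : realType) : measurable_fun setT (@clamp01 R).
Proof. by apply: measurable_maxr => //; exact: measurable_minr. Qed.

Section TreeSolution.
Context (R : realType) d (Omega : measurableType d) (P : probability Omega R)
  (N : vertex -> {RV P >-> enat}) (C : vertex -> {RV P >-> R}).
Hypothesis C_sol : tree_solution N C.

Variable mu : R.
Hypotheses (mu01 : 0 <= mu <= 1) (C_mean : forall u, mean P (C u) = mu).

Let mN u : measurable_fun setT (N u) := measurable_funPT (N u).
Let mC u : measurable_fun setT (C u) := measurable_funPT (C u).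
Let C01 u w : 0 <= C u w <= 1. Proof. by case: C_sol. Qed.

Let sigma_N D A : sigma_family D (fun v => N v : Omega -> enat) A -> measurable A.
Proof. exact: sigma_family_measurable. Qed.

Let mean_solution_level n (S : seq vertex) A :
  (forall u, u \in S -> size u = n) -> uniq S ->
  sigma_family [set v | (size v < n)%N] (fun v => N v : Omega -> enat) A ->
  mean P (fun w => \1_A w * \prod_(u <- S) C u w) =
  mean P \1_A * \prod_(u <- S) mu.
Proof.
move=> Sn uS sA; have [_ /(_ n)[iC iCN] _ _] := C_sol.
have SD : {subset S <= [set u : vertex | size u = n]} by move=> u /Sn; rewrite inE.
have -> : \prod_(u <- S) mu = \prod_(u <- S) mean P (fun w => clamp01 (C u w)).
  apply: eq_bigr => u _; rewrite -(C_mean u).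
  by apply: eq_mean => w; rewrite clamp01_id.
rewrite -(mean_prod_independent iC iCN mC sA (sigma_N sA) SD uS
  (fun=> @measurable_clamp01 R) (fun=> @clamp01_01 R)).
by apply: eq_mean => w; congr (_ * _); apply: eq_bigr => u _; rewrite clamp01_id.
Qed.

(** Both sides obey the same recursion when a vertex is opened, so no moment is computed and A may
    involve N at any vertex before generation n. At generation n itself, independence of the
    solution from the earlier N replaces each value by its mean mu. *)
Lemma mean_solution_truncated n j m (S : seq vertex) A : (m + j)%N = n ->
  (forall u, u \in S -> size u = m) -> uniq S ->
  sigma_family [set v | (size v < n)%N] (fun v => N v : Omega -> enat) A ->
  mean P (fun w => \1_A w * \prod_(u <- S) C u w) =
  mean P (fun w => \1_A w * \prod_(u <- S) truncated N mu j u w).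
Proof.
elim: j m S A => [|j IH] m S A mj Sm uS sA; have mA := sigma_N sA.
  rewrite addn0 in mj; subst m; rewrite (mean_solution_level Sm uS sA).
  under [RHS]eq_mean do rewrite mulrC /=.
  by rewrite (meanZ P (\prod_(u <- S) mu)) 1?mulrC//; exact: bounded_measurable_indic.
have btr i s : bounded_measurable (fun w => \prod_(u <- s) truncated N mu i u w).
  by apply: bounded_measurable_prod => u; exact: bounded_measurable_truncated.
have bC s : bounded_measurable (fun w => \prod_(u <- s) C u w).
  by apply: bounded_measurable_prod => u; exact: bounded_measurable01.
suff inner S' S1 B : (forall u, u \in S' -> size u = m) -> uniq S' ->
    (forall u, u \in S1 -> size u = m.+1) -> uniq S1 ->
    (forall u i, u \in S' -> rcons u i \notin S1) ->
    sigma_family [set v | (size v < n)%N] (fun v => N v : Omega -> enat) B ->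
  mean P (fun w => \1_B w * ((\prod_(u <- S') C u w) * \prod_(u <- S1) C u w)) =
  mean P (fun w => \1_B w * ((\prod_(u <- S') truncated N mu j.+1 u w) *
    \prod_(u <- S1) truncated N mu j u w)).
  have := inner S [::] A Sm uS _ isT _ sA => h.
  transitivity (mean P (fun w => \1_A w *
      ((\prod_(u <- S) C u w) * \prod_(u <- [::]) C u w))).
    by apply: eq_mean => w; rewrite big_nil mulr1.
  by rewrite h//; apply: eq_mean => w; rewrite big_nil mulr1.
elim: S' S1 B {Sm uS sA mA} => [|u S' IHS] S1 B Sm uS S1m uS1 SS1 sB;
    have mB := sigma_N sB.
  have := IH m.+1 S1 B _ S1m uS1 sB; rewrite addSnnS => /(_ mj) h.
  under eq_mean do rewrite big_nil mul1r; rewrite h.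
  by apply: eq_mean => w; rewrite big_nil mul1r.
move: uS; rewrite /= => /andP[uS' uS].
have um : size u = m by exact: (Sm u (mem_head _ _)).
have {}Sm v : v \in S' -> size v = m by move=> vS; apply: Sm; rewrite inE vS orbT.
pose Z w := \1_B w * ((\prod_(v <- S') C v w) * \prod_(v <- S1) C v w).
pose Z' w := \1_B w * ((\prod_(v <- S') truncated N mu j.+1 v w) *
  \prod_(v <- S1) truncated N mu j v w).
have bZ : bounded_measurable Z.
  apply: bounded_measurableM; first exact: bounded_measurable_indic.
  exact: bounded_measurableM.
have bZ' : bounded_measurable Z'.
  apply: bounded_measurableM; first exact: bounded_measurable_indic.
  exact: bounded_measurableM.
have beC : bounded_measurable (fun w => eprod (N u w) (fun i => C (rcons u i) w)).
  apply: bounded_measurable01 => [|w]; last exact: eprod01.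
  by apply: (measurable_eprod (mN u)).
have betr : bounded_measurable
    (fun w => eprod (N u w) (fun i => truncated N mu j (rcons u i) w)).
  apply: bounded_measurable01 => [|w]; last first.
    by apply: eprod01 => i; exact: truncated01.
  apply: (measurable_eprod (mN u)) => [i|i w]; first exact: measurable_truncated.
  exact: truncated01.
transitivity (mean P (fun w => Z w * (1 - eprod (N u w) (fun i => C (rcons u i) w)))).
  have [_ _ Cu _] := C_sol; apply: ae_eq_mean.
  - by apply: (bounded_measurableM _ _).1 => //; first exact: bounded_measurable_indic;
      exact: bounded_measurableM.
  - by apply: (bounded_measurableM bZ _).1; exact: bounded_measurableB.
  - by apply: filterS (Cu u) => w Cw; rewrite big_cons Cw /Z; ring.
transitivity (mean P (fun w => Z' w *
    (1 - eprod (N u w) (fun i => truncated N mu j (rcons u i) w)))); last first.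
  by apply: eq_mean => w; rewrite big_cons /Z' /=; ring.
(* The term 1 makes u disappear; the product is compared on each event N = ev at u, where it adds l
   daughters to S1. *)
rewrite !mean_mul_one_sub//; congr (_ - _).
  by apply: IHS => // v i vS; apply: SS1; rewrite inE vS orbT.
apply: (@mean_eprod_transfer _ _ _ _ _ P P (N u) (N u) (fun i => C (rcons u i))
  (fun i => truncated N mu j (rcons u i)) Z Z') => //.
- by move=> i; exact: measurable_truncated.
- by move=> i w; exact: truncated01.
move=> ev l.
have := IHS (children u l ++ S1) (B `&` (N u @^-1` [set ev])).
have E1 (F G : vertex -> Omega -> R) w : \1_(B `&` (N u @^-1` [set ev])) w *
    ((\prod_(v <- S') F v w) * \prod_(v <- children u l ++ S1) G v w) =
    (\1_B w * ((\prod_(v <- S') F v w) * \prod_(v <- S1) G v w)) *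
    (\1_(N u @^-1` [set ev]) w * \prod_(i < l) G (rcons u i) w).
  by rewrite big_cat /= (prod_children _ _ (fun v => G v w)) indicI /=; ring.
move=> h; transitivity (mean P (fun w => \1_(B `&` (N u @^-1` [set ev])) w *
    ((\prod_(v <- S') C v w) * \prod_(v <- children u l ++ S1) C v w))).
  by apply: eq_mean => w; exact/esym/(E1 (fun v => C v) (fun v => C v)).
rewrite h//.
- apply: eq_mean => w.
  exact: (E1 (fun v => truncated N mu j.+1 v) (fun v => truncated N mu j v)).
- by move=> v; rewrite mem_cat => /orP[/size_children ->|/S1m//]; rewrite um.
- by apply: uniq_children => // i; apply: SS1; exact: mem_head.
- move=> v i vS; apply: notin_children; first by apply: contraNneq uS' => <-.
  by apply: SS1; rewrite inE vS orbT.
- apply: sigma_familyI => //; apply: sigma_family_preimage => //=.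
  by rewrite um -mj addnS ltnS leq_addr.
Qed.

End TreeSolution.

(** * Approximation of events by events of finite depth *)

Section SetDistance.
Context d (T : measurableType d) (R : realType) (P : probability T R).
Implicit Types A B : set T.

(** The probability of the symmetric difference, written as an expectation so that its inequalities
    can be checked pointwise. *)
Definition set_dist A B : R := mean P (fun w => `|\1_A w - \1_B w|).

Lemma bounded_measurable_dist A B : measurable A -> measurable B ->
  bounded_measurable (fun w => `|\1_A w - \1_B w| : R).
Proof.
move=> mA mB; split; last first.
  exists 1 => w; rewrite normr_id !indicE.
  by do 2 case: (_ \in _); rewrite ?subrr ?subr0 ?sub0r ?normrN ?normr0 ?normr1.
by apply: measurableT_comp => //; apply: measurable_funB; exact: measurable_indic.
Qed.

Lemma mean_set_dist (f : T -> R) A B : measurable_fun setT f ->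
  (forall w, 0 <= f w <= 1) -> measurable A -> measurable B ->
  mean P (fun w => f w * \1_A w) <= mean P (fun w => f w * \1_B w) + set_dist A B.
Proof.
move=> mf f01 mA mB; have bf := bounded_measurable01 mf f01.
have bD := bounded_measurable_dist mA mB.
have bfX X : measurable X -> bounded_measurable (fun w => f w * \1_X w).
  by move=> mX; apply: bounded_measurableM => //; exact: bounded_measurable_indic.
rewrite -meanD//; last exact: bfX.
apply: le_mean; [exact: bfX|by apply: bounded_measurableD => //; exact: bfX|].
move=> w; have /andP[? ?] := f01 w; rewrite !indicE.
by do 2 case: (_ \in _);
  rewrite ?subrr ?subr0 ?sub0r ?normrN ?normr0 ?normr1 ?mulr1 ?mulr0; lra.
Qed.

Lemma set_dist_ge0 A B : 0 <= set_dist A B.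
Proof. exact: mean_ge0. Qed.

Lemma set_distU A1 A2 B1 B2 : measurable A1 -> measurable A2 ->
  measurable B1 -> measurable B2 ->
  set_dist (A1 `|` A2) (B1 `|` B2) <= set_dist A1 B1 + set_dist A2 B2.
Proof.
move=> mA1 mA2 mB1 mB2; rewrite -meanD; try exact: bounded_measurable_dist.
apply: le_mean.
- by apply: bounded_measurable_dist; exact: measurableU.
- by apply: bounded_measurableD; exact: bounded_measurable_dist.
move=> w; rewrite !indicE !in_setU.
by do 4 case: (_ \in _); rewrite /= ?subrr ?subr0 ?sub0r ?normrN ?normr0 ?normr1; lra.
Qed.

Lemma set_dist_triangle A B D : measurable A -> measurable B -> measurable D ->
  set_dist A D <= set_dist A B + set_dist B D.
Proof.
move=> mA mB mD; rewrite -meanD; try exact: bounded_measurable_dist.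
apply: le_mean; first exact: bounded_measurable_dist.
  by apply: bounded_measurableD; exact: bounded_measurable_dist.
by move=> w; exact: ler_distD.
Qed.

Lemma set_dist_bigcup (A : nat -> set T) e : (forall i, measurable (A i)) -> 0 < e ->
  exists k, set_dist (\bigcup_i A i) (\bigcup_(i < k) A i) <= e.
Proof.
move=> mA e0; have mU : measurable (\bigcup_i A i) by exact: bigcup_measurable.
have mUk k : measurable (\bigcup_(i < k) A i) by exact: bigcup_measurable.
have : set_dist (\bigcup_i A i) (\bigcup_(i < k) A i) @[k --> \oo] --> (0 : R).
  rewrite -[X in _ --> X](mean_cst P (0 : R)); apply: (@mean_cvg _ _ _ _ _ _ 1).
  - by move=> k; case: (bounded_measurable_dist mU (mUk k)).
  - exact: measurable_cst.
  - move=> k w; rewrite normr_id !indicE.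
    by do 2 case: (_ \in _); rewrite ?subrr ?subr0 ?sub0r ?normrN ?normr0 ?normr1.
  - move=> w; apply: cvg_near_cst.
    have [[i _ Aiw]|nA] := pselect ((\bigcup_i A i) w).
      exists i.+1 => // k /= ik; rewrite !indicE !mem_set ?subrr ?normr0//.
        by exists i.
      by exists i.
    apply: nearW => k; rewrite !indicE !memNset ?subrr ?normr0//.
    by move=> [i _ Aiw]; apply: nA; exists i.
move=> /cvgrPdist_le/(_ e e0)[k _ /(_ k (leqnn k))].
rewrite sub0r normrN ger0_norm ?set_dist_ge0//.
by exists k.
Qed.

End SetDistance.

Section Approximation.
Context (R : realType) d (Omega : measurableType d) (P : probability Omega R)
  (N : vertex -> {RV P >-> enat}).

Let F n : set_system Omega :=
  sigma_family [set v | (size v < n)%N] (fun v => N v : Omega -> enat).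

Let mF n A : F n A -> measurable A.
Proof. exact: sigma_family_measurable. Qed.

Let F_le n m A : (n <= m)%N -> F n A -> F m A.
Proof. by move=> nm; apply: sigma_family_sub => v /= /leq_trans; exact. Qed.

Let approx : set_system Omega := [set A | measurable A /\
  forall e, 0 < e -> exists n A', F n A' /\ set_dist P A A' <= e].

Let approxU A B : approx A -> approx B -> approx (A `|` B).
Proof.
move=> [mA hA] [mB hB]; split=> [|e e0]; first exact: measurableU.
have e20 : 0 < e / 2 by rewrite divr_gt0.
have [n [A' [FA' dA]]] := hA _ e20; have [m [B' [FB' dB]]] := hB _ e20.
exists (maxn n m), (A' `|` B'); split.
  apply: (@measurableU _ (g_sigma_algebraType _)).
    exact: F_le (leq_maxl _ _) FA'.
  exact: F_le (leq_maxr _ _) FB'.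
have := set_distU P mA mB (mF FA') (mF FB'); lra.
Qed.

(** The events with this property form a sigma-algebra containing the events of each single N. For a
    countable union, half of e pays for the passage to a finite union and half for approximating the
    latter. *)
Lemma sigma_family_approx A e :
  sigma_family setT (fun v => N v : Omega -> enat) A -> 0 < e ->
  exists n A', sigma_family [set v | (size v < n)%N]
      (fun v => N v : Omega -> enat) A' /\ set_dist P A A' <= e.
Proof.
move=> sA; suff [_ h] : approx A by exact: h.
move: A sA; apply: smallest_sub; last first.
  move=> _ [v _ [B mB <-]]; rewrite setTI.
  have FvB : F (size v).+1 (N v @^-1` B) by apply: sigma_family_preimage => /=.
  split=> [|e' e0]; first exact: mF FvB.
  exists (size v).+1, (N v @^-1` B); split=> //.
  rewrite /set_dist; under eq_mean do rewrite subrr normr0.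
  by rewrite mean_cst ltW.
have a0 : approx set0.
  split=> [//|e' e0]; exists 0%N, set0; split.
    exact: (@measurable0 _ (g_sigma_algebraType _)).
  rewrite /set_dist; under eq_mean do rewrite subrr normr0.
  by rewrite mean_cst ltW.
split=> [//|A [mA hA]|A hA].
  split=> [|e' e0]; first exact: measurableD.
  have [n [A' [FA' dA]]] := hA _ e0; exists n, (setT `\` A'); split.
    rewrite setTD; exact: (@measurableC _ (g_sigma_algebraType _)).
  apply: le_trans dA; rewrite !setTD; have mA' := mF FA'.
  apply: le_mean; try exact: bounded_measurable_dist.
    by apply: bounded_measurable_dist; exact: measurableC.
  move=> w; rewrite !indicE !in_setC.
  by do 2 case: (_ \in _); rewrite /= ?subrr ?subr0 ?sub0r ?normrN ?normr0 ?normr1.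
have mA i : measurable (A i) by case: (hA i).
have hU k : approx (\bigcup_(i < k) A i).
  rewrite bigcup_mkord; elim: k => [|k IH]; first by rewrite big_ord0.
  by rewrite big_ord_recr; exact: approxU.
split=> [|e' e0]; first exact: bigcup_measurable.
have e20 : 0 < e' / 2 by rewrite divr_gt0.
have [k dk] := set_dist_bigcup P mA e20.
have [mU /(_ _ e20)[n [A' [FA' dA]]]] := hU k.
exists n, A'; split=> //.
have mUA : measurable (\bigcup_i A i) by exact: bigcup_measurable.
by rewrite (le_trans (set_dist_triangle P mUA mU (mF FA')))// [leRHS]splitr lerD.
Qed.

End Approximation.

(** * The second moment of an endogenous solution *)

Lemma mulr_le_half_sqr (R : realType) (x y : R) :
  x * y <= 2^-1 * (x ^+ 2 + y ^+ 2).
Proof. by have := sqr_ge0 (x - y); rewrite sqrrB; lra. Qed.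

Section Endogeny.
Context (R : realType) d (Omega : measurableType d) (P : probability Omega R)
  (N : vertex -> {RV P >-> enat}) (C : vertex -> {RV P >-> R}).
Hypotheses (C_sol : tree_solution N C) (C_endo : endogenous N C).
Variables (mu b : R).
Hypotheses (mu01 : 0 <= mu <= 1) (C_mean : forall u, mean P (C u) = mu)
  (truncated_b : forall n, mean P (fun w => truncated N mu n [::] w ^+ 2) <= b).

(* If the second moment of the root were [mu], then the root would be the
   indicator of an event, which is approximated by events of finite depth; but
   the projection of the root on finite depth has second moment at most [b]. *)
Lemma endogenous_second_moment :
  mean P (fun w => C [::] w ^+ 2) = mu -> mu <= b.
Proof.
pose X : Omega -> R := C [::]; move=> C2.
have X01 w : 0 <= X w <= 1 by have [h _ _ _] := C_sol; exact: h.
have mX : measurable_fun setT X by exact: (measurable_funPT (C [::])).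
have bX := bounded_measurable01 mX X01.
(* Since X and X^2 have the same mean, X is almost surely 0 or 1, and B is the event X = 1 up to a
   null set. With the level 1/2 every error is dominated by 2 (X - X^2), whose mean is 0. *)
pose B := X @^-1` `[2^-1, +oo[.
have mB : measurable B by rewrite -[B]setTI; exact: mX.
have bB := @bounded_measurable_indic _ _ R _ mB.
have BE w : \1_B w = (2^-1 <= X w)%R%:R :> R.
  by rewrite indicE; congr (_%:R); congr nat_of_bool; apply/idP/idP;
    rewrite inE /B /= in_itv/= andbT.
have bX2 : bounded_measurable (fun w => X w - X w ^+ 2).
  by apply: bounded_measurableB => //; exact: bounded_measurableX.
have bX2' := bounded_measurableZ 2 bX2.
have D0 : mean P (fun w => 2 * (X w - X w ^+ 2)) = 0.
  rewrite meanZ// meanB//; last exact: bounded_measurableX.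
  by rewrite C2 C_mean subrr mulr0.
have XB : mu <= mean P (fun w => X w * \1_B w).
  rewrite -[leRHS]addr0 -D0 -meanD//; last exact: bounded_measurableM.
  rewrite -(C_mean [::]); apply: le_mean => //.
    by apply: bounded_measurableD => //; exact: bounded_measurableM.
  move=> w; rewrite BE; have /andP[? ?] := X01 w; rewrite -/X.
  by have [?|?] := leP (2^-1) (X w); rewrite ?mulr1 ?mulr0; nra.
have PB : mean P \1_B <= mu.
  rewrite -(C_mean [::]) -[leRHS]addr0 -D0 -meanD//.
  apply: le_mean => //; first exact: bounded_measurableD.
  move=> w; rewrite BE; have /andP[? ?] := X01 w; rewrite -/X.
  by have [?|?] := leP (2^-1) (X w) => /=; nra.
have [A sA [Z [M [sM PM ZM]] BAZ]] := C_endo [::] (measurable_itv `[2^-1, +oo[).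
have mA : measurable A by exact: sigma_family_measurable sA.
have mM : measurable M by exact: sigma_family_measurable sM.
have dAB : set_dist P B A <= 0.
  have -> : 0 = mean P \1_M :> R by rewrite mean_indicE// PM.
  apply: le_mean; [exact: bounded_measurable_dist|exact: bounded_measurable_indic|].
  move=> w; rewrite /B -BAZ !indicE in_setU.
  have : (w \in Z) ==> (w \in M) by apply/implyP; rewrite !inE; exact: ZM.
  by do 3 case: (_ \in _) => //=; rewrite ?subrr ?subr0 ?sub0r ?normr0 ?normr1 ?ler01.
have dBA : set_dist P A B <= 0.
  by rewrite /set_dist; under eq_mean do rewrite distrC.
(* Let t be the projection and A' the event of finite depth. Then mu <= E[X 1_B] <= E[X 1_A'] + e =
   E[t 1_A'] + e <= (b + P(A')) / 2 + e, and P(A') <= mu + e. Solving for mu yields the constant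
   3. *)
suff key (e : R) : 0 < e -> mu <= b + 3 * e.
  apply/ler_addgt0Pr => e e0.
  by have := key _ (divr_gt0 e0 (ltr0n R 3)); rewrite mulrCA divff ?mulr1.
move=> e0.
have [n [A' [FA' dA]]] := sigma_family_approx sA e0.
have mA' : measurable A' by exact: sigma_family_measurable FA'.
have dA' : set_dist P A' A <= e.
  by rewrite /set_dist; under eq_mean do rewrite distrC.
have bA' := @bounded_measurable_indic _ _ R _ mA'.
have h1 := mean_set_dist P mX X01 mB mA.
have h2 := mean_set_dist P mX X01 mA mA'.
have c11 (w : Omega) : 0 <= (1 : R) <= 1 by rewrite ler01 lexx.
have h3 := mean_set_dist P (@measurable_cst _ _ _ _ setT (1 : R)) c11 mA' mA.
have h4 := mean_set_dist P (@measurable_cst _ _ _ _ setT (1 : R)) c11 mA mB.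
have c1E (S : set Omega) : mean P (fun w => cst (1 : R) w * \1_S w) = mean P \1_S.
  by apply: eq_mean => w; rewrite mul1r.
rewrite !c1E in h3 h4.
have bt := bounded_measurable_truncated N mu01 n [::].
have h5 : mean P (fun w => X w * \1_A' w) =
    mean P (fun w => truncated N mu n [::] w * \1_A' w).
  have := mean_solution_truncated C_sol mu01 C_mean (add0n n) (S := [:: [::]]) _ isT FA'.
  move=> h; transitivity (mean P (fun w => \1_A' w * \prod_(u <- [:: [::]]) C u w)).
    by apply: eq_mean => w; rewrite big_seq1 mulrC.
  rewrite h; first by apply: eq_mean => w; rewrite big_seq1 mulrC.
  by move=> u; rewrite inE => /eqP ->.
have h6 : mean P (fun w => truncated N mu n [::] w * \1_A' w) <=
    2^-1 * (mean P (fun w => truncated N mu n [::] w ^+ 2) + mean P \1_A').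
  have bt2 := bounded_measurableX 2 bt.
  rewrite -meanD// -meanZ; last exact: bounded_measurableD.
  apply: le_mean; first exact: bounded_measurableM.
    by apply: bounded_measurableZ; exact: bounded_measurableD.
  move=> w; rewrite [X in _ <= _ * (_ + X)](_ : _ = \1_A' w ^+ 2).
    exact: mulr_le_half_sqr.
  by rewrite indicE; case: (_ \in _); rewrite ?expr1n ?expr0n.
have h7 := truncated_b n.
clear - XB PB dAB dBA dA dA' h1 h2 h3 h4 h5 h6 h7; lra.
Qed.

End Endogeny.
(** * Moments and weak convergence *)

Section Bernstein.
Context {R : realType}.
Implicit Types (g h : nat -> R) (x : R).

(* The expectation of [g] under the binomial law of parameters n and 'X, by
   conditioning on the first trial. *)
Fixpoint bernstein n g : {poly R} :=
  if n is n'.+1 then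
    'X * bernstein n' (fun k => g k.+1) + (1 - 'X) * bernstein n' g
  else (g 0%N)%:P.

Lemma bernsteinS n g x : (bernstein n.+1 g).[x] =
  x * (bernstein n (fun k => g k.+1)).[x] + (1 - x) * (bernstein n g).[x].
Proof. by rewrite /= !hornerE. Qed.

Lemma bernstein_affine n g a c x :
  (bernstein n (fun k => a + c * g k)).[x] = a + c * (bernstein n g).[x].
Proof.
elim: n g => [|n IH] g; first by rewrite /= !hornerE.
by rewrite !bernsteinS !IH; ring.
Qed.

Lemma bernstein_le n g h x : 0 <= x <= 1 ->
  (forall k, (k <= n)%N -> g k <= h k) -> (bernstein n g).[x] <= (bernstein n h).[x].
Proof.
move=> /andP[x0 x1]; elim: n g h => [|n IH] g h gh; first by rewrite /= !hornerE gh.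
rewrite !bernsteinS; apply: lerD; apply: ler_wpM2l; rewrite ?subr_ge0//.
  by apply: IH => k kn; exact: gh.
by apply: IH => k kn; exact/gh/leqW.
Qed.

(** At b = - n x this is the binomial variance. The shift b stays free because a success in the
    first trial replaces it by 1 + b. *)
Lemma bernstein_sqr n x b : (bernstein n (fun k => (k%:R + b) ^+ 2)).[x] =
  (n%:R * x + b) ^+ 2 + n%:R * (x * (1 - x)).
Proof.
elim: n b => [|n IH] b; first by rewrite /= hornerC !mul0r addr0.
rewrite bernsteinS IH.
under [in X in x * X]eq_fun do rewrite -natr1 -addrA.
by rewrite (IH (1 + b)) -natr1; ring.
Qed.

End Bernstein.

Section Weierstrass.
Context {R : realType}.
Variable f : R -> R.
Hypothesis cf : {within `[0, 1], continuous f}.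

Lemma unif_continuous01 (e : R) : 0 < e -> exists2 r : R, 0 < r &
  forall x y, 0 <= x <= 1 -> 0 <= y <= 1 -> `|x - y| < r -> `|f x - f y| <= e.
Proof.
move=> e0.
have /compact_near_coveringP := @segment_compact R 0 1.
move=> /(_ _ (0^'+) (fun r x => 0 <= x <= 1 -> forall y, 0 <= y <= 1 ->
  `|x - y| < r -> `|f x - f y| <= e) _).
have h (x : R) : x \in `[0, 1] -> \forall x' \near x & r \near (0:R)^'+,
    0 <= x' <= 1 -> forall y, 0 <= y <= 1 -> `|x' - y| < r -> `|f x' - f y| <= e.
  move=> x01; have e20 : 0 < e / 2 by rewrite divr_gt0.
  have /subspace_continuousP/(_ x x01)/cvgrPdist_lt/(_ _ e20) := cf.
  rewrite near_withinE => /nbhs_ballP[r /= r0 xr].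
  have r20 : 0 < r / 2 by rewrite divr_gt0.
  exists (ball x (r / 2), [set r' | r' < r / 2]).
    split; first exact: nbhsx_ballx.
    by exists (r / 2) => //= r' /=; rewrite sub0r normrN => /ltr_normlW h _.
  move=> [x' r'] /= [xx' r'r] x'01 y y01 xy.
  have h1 := xr x' _ x'01; have h2 := xr y _ y01.
  have {}h1 : `|f x - f x'| < e / 2.
    apply: h1; rewrite /ball /= in xx' *; rewrite (lt_trans xx')//.
    by rewrite ltr_pdivrMr// mulr_natr mulr2n ltrDl.
  have {}h2 : `|f x - f y| < e / 2.
    apply: h2; rewrite /ball /= in xx' *.
    rewrite (le_lt_trans (ler_distD x' _ _))// [ltRHS]splitr ltrD//.
    exact: lt_trans xy r'r.
  rewrite distrC in h1.
  by rewrite (le_trans (ler_distD (f x) _ _))// [leRHS]splitr lerD// ltW.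
move=> /(_ h) [r /= r0 hr]; exists (r / 2); first by rewrite divr_gt0.
move=> x y x01 y01 xy; apply: (hr (r / 2)) => //=.
  rewrite sub0r normrN gtr0_norm ?divr_gt0// ltr_pdivrMr// mulr_natr mulr2n ltrDl//.
by rewrite divr_gt0.
Qed.

Lemma bounded_continuous01 : exists M, forall x, 0 <= x <= 1 -> `|f x| <= M.
Proof.
have /compact_bounded[M [_ hM]] := continuous_compact cf (@segment_compact R 0 1).
exists (M + 1) => x x01; apply: (hM (M + 1)); first by rewrite ltrDl.
by exists x => //=; rewrite in_itv.
Qed.

(** Uniform continuity near the diagonal and boundedness away from it give |f x - f y| <= e/2 + K (x
    - y)^2 throughout. Averaged over the binomial frequency, which has mean x, the quadratic term is
    at most K / (n+1). *)
Lemma weierstrass01 (e : R) : 0 < e ->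
  exists p : {poly R}, forall x, 0 <= x <= 1 -> `|f x - p.[x]| <= e.
Proof.
move=> e0; have [M fM] := bounded_continuous01.
have e20 : 0 < e / 2 by rewrite divr_gt0.
have [r r0 fr] := unif_continuous01 e20.
pose K := 2 * M / r ^+ 2.
have M0 : 0 <= M by rewrite (le_trans _ (fM 0 _))// lexx ler01.
have K0 : 0 <= K by apply: divr_ge0; [exact: mulr_ge0|exact: sqr_ge0].
have fK x y : 0 <= x <= 1 -> 0 <= y <= 1 ->
    `|f x - f y| <= e / 2 + K * (x - y) ^+ 2.
  move=> x01 y01; have [xy|xy] := ltP `|x - y| r.
    by rewrite (le_trans (fr _ _ x01 y01 xy))// lerDl mulr_ge0// sqr_ge0.
  have : 2 * M <= K * (x - y) ^+ 2.
    rewrite /K mulrAC ler_pdivlMr ?exprn_gt0// ler_wpM2l ?mulr_ge0//.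
    by rewrite -[leRHS]real_normK ?num_real// lerXn2r// nnegrE ltW.
  have := ler_normB (f x) (f y); have := fM _ x01; have := fM _ y01.
  by move: e20; lra.
have [n nK] : exists n : nat, K / (e / 2) < n.+1%:R.
  exists (Num.trunc (K / (e / 2))); exact: truncnS_gt.
have n0 : 0 < n.+1%:R :> R by rewrite ltr0n.
exists (bernstein n.+1 (fun k => f (k%:R / n.+1%:R))) => x x01.
pose c := K / n.+1%:R ^+ 2.
have hk k : (k <= n.+1)%N -> `|f (k%:R / n.+1%:R) - f x| <=
    e / 2 + c * (k%:R + (- (n.+1%:R * x))) ^+ 2.
  move=> kn; apply: le_trans (fK _ _ _ x01) _.
    by rewrite divr_ge0//= ler_pdivrMr// mul1r ler_nat.
  rewrite lerD2l /c -mulrA ler_wpM2l// [leRHS]mulrC -expr_div_n mulrDl mulNr.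
  by rewrite [n.+1%:R * x]mulrC mulfK ?gt_eqF.
have cb : c * (n.+1%:R * (x * (1 - x))) <= e / 2.
  have /andP[x0 x1] := x01.
  have xx : x * (1 - x) <= 1 by rewrite mulr_ile1// ?subr_ge0// lerBlDr lerDl.
  have -> : c * (n.+1%:R * (x * (1 - x))) = K * (x * (1 - x)) / n.+1%:R.
    by rewrite /c; field; rewrite gt_eqF.
  rewrite ler_pdivrMr// (le_trans (ler_piMr K0 xx))//.
  by rewrite mulrC -ler_pdivrMr// ltW.
have sq : (bernstein n.+1 (fun k => (k%:R + (- (n.+1%:R * x))) ^+ 2)).[x] =
    n.+1%:R * (x * (1 - x)).
  by rewrite bernstein_sqr subrr expr0n add0r.
have up : (bernstein n.+1 (fun k => f (k%:R / n.+1%:R))).[x] <= f x + e / 2 +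
    c * (n.+1%:R * (x * (1 - x))).
  rewrite -sq -bernstein_affine; apply: bernstein_le => // k kn.
  by have := hk k kn; rewrite ler_norml => /andP[_]; lra.
have lo : f x - e / 2 + (- c) * (n.+1%:R * (x * (1 - x))) <=
    (bernstein n.+1 (fun k => f (k%:R / n.+1%:R))).[x].
  rewrite -sq -bernstein_affine; apply: bernstein_le => // k kn.
  by have := hk k kn; rewrite ler_norml => /andP[+ _]; lra.
by rewrite ler_norml; apply/andP; split; lra.
Qed.

End Weierstrass.

Lemma cvg_sum_seq (R : realType) (I : Type) (s : seq I) (u : I -> nat -> R) (l : I -> R) :
  (forall i, u i n @[n --> \oo] --> l i) ->
  \sum_(i <- s) u i n @[n --> \oo] --> \sum_(i <- s) l i.
Proof.
move=> ul; elim: s => [|i s IH].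
  by rewrite big_nil; under eq_fun do rewrite big_nil; exact: cvg_cst.
by rewrite big_cons; under eq_fun do rewrite big_cons; exact: cvgD.
Qed.

Section MomentConvergence.
Context {R : realType}.
Implicit Types nu : probability R R.

Definition moment nu (k : nat) : R := \int[nu]_(x in `[0, 1]) x ^+ k.

(** Extension by 0 turns integrals over [0, 1] into means over R, to which the lemmas on [mean]
    apply whatever the measure does outside [0, 1]. *)
Definition unit_part (f : R -> R) : R -> R := f \_ `[0, 1].

Lemma integral_unit nu f : \int[nu]_(x in `[0, 1]) f x = mean nu (unit_part f).
Proof. exact: Rintegral_mkcond. Qed.

Lemma bounded_measurable_unit (f : R -> R) :
  {within `[0, 1], continuous f} -> bounded_measurable (unit_part f).
Proof.
move=> cf; split.
  apply/(measurable_restrictT f (measurable_itv `[0, 1])).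
  by apply: subspace_continuous_measurable_fun => //; exact: measurable_itv.
have [M fM] := bounded_continuous01 cf.
exists M => x; rewrite /unit_part patchE; case: ifPn => [|_].
  by rewrite inE /= in_itv /= => /fM.
by rewrite normr0 (le_trans _ (fM 0 _))// lexx ler01.
Qed.

Lemma continuous_within01 (f : R -> R) : continuous f ->
  {within `[0, 1], continuous f}.
Proof. by move=> cf; exact: continuous_subspaceT. Qed.

Lemma bounded_measurable_pow01 k : bounded_measurable (unit_part (fun x => x ^+ k)).
Proof.
by apply/bounded_measurable_unit/continuous_within01 => x; exact: exprn_continuous.
Qed.

Lemma integral_horner nu (p : {poly R}) :
  \int[nu]_(x in `[0, 1]) p.[x] = \sum_(i < size p) p`_i * moment nu i.
Proof.
rewrite integral_unit (_ : unit_part _ =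
    fun x => \sum_(i < size p) p`_i * unit_part (fun x => x ^+ i) x); last first.
  apply/funext => x; rewrite /unit_part patchE; case: ifPn => xI.
    by rewrite horner_coef; apply: eq_bigr => i _; rewrite patchE xI.
  by rewrite big1// => i _; rewrite patchE (negbTE xI) mulr0.
rewrite mean_sum; last by move=> i; apply: bounded_measurableZ; exact: bounded_measurable_pow01.
apply: eq_bigr => i _; rewrite meanZ; last exact: bounded_measurable_pow01.
by rewrite /moment integral_unit.
Qed.

Lemma weak_cvg_moments (nu_ : nat -> probability R R) nu :
  (forall k, moment (nu_ n) k @[n --> \oo] --> moment nu k) -> weak_cvg01 nu_ nu.
Proof.
move=> cm f cf; apply/cvgrPdist_le => e e0.
have e30 : 0 < e / 3 by rewrite divr_gt0.
have [p fp] := weierstrass01 cf e30.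
have cp : {within `[0, 1], continuous (fun x => p.[x])}.
  by apply: continuous_within01 => x; exact: continuous_horner.
have close (rho : probability R R) :
    `|\int[rho]_(x in `[0, 1]) f x - \int[rho]_(x in `[0, 1]) p.[x]| <= e / 3.
  rewrite !integral_unit; apply: mean_norm_le; try exact: bounded_measurable_unit.
  move=> x; rewrite /unit_part !patchE; case: ifPn => [|_].
    by rewrite inE /= in_itv /= => /fp.
  by rewrite subrr normr0 ltW.
have : \int[nu_ n]_(x in `[0, 1]) p.[x] @[n --> \oo] --> \int[nu]_(x in `[0, 1]) p.[x].
  rewrite integral_horner; under eq_fun do rewrite integral_horner.
  by apply: cvg_sum_seq => i; apply: cvgMr; exact: cm.
move=> /cvgrPdist_le/(_ _ e30); apply: filterS => n hn.
have := close nu; have := close (nu_ n); move: hn.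
rewrite !ler_norml; move: (Rintegral _ _ _) (Rintegral _ _ _) (Rintegral _ _ _) (Rintegral _ _ _).
by move=> a b c d' /andP[? ?] /andP[? ?] /andP[? ?]; apply/andP; split; lra.
Qed.

Lemma moment_distribution d (T : measurableType d) (P : probability T R)
    (X : {RV P >-> R}) nu k :
  (forall w, 0 <= X w <= 1) -> eq_law (distribution P X) nu ->
  moment nu k = mean P (fun w => X w ^+ k).
Proof.
move=> X01 PX; rewrite /moment integral_unit -(eq_mean_measure _ PX).
rewrite mean_pushforward; last exact: bounded_measurable_pow01.
by apply: eq_mean => w; rewrite /= /unit_part patchE mem_set//= in_itv/= X01.
Qed.

Lemma moment1 nu : moment nu 1 = mean01 nu.
Proof. by []. Qed.

Lemma moment0 nu : prob01 nu -> moment nu 0 = 1.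
Proof.
move=> nu01; rewrite /moment; under eq_Rintegral do rewrite expr0.
by rewrite Rintegral_cst//= nu01 mul1r.
Qed.

Lemma moment01 nu k : 0 <= moment nu k <= 1.
Proof.
rewrite /moment integral_unit; apply: mean01P; first by case: (bounded_measurable_pow01 k).
move=> x; rewrite /unit_part patchE; case: ifPn => [|_]; last by rewrite lexx ler01.
by rewrite inE /= in_itv /= => /andP[? ?]; rewrite exprn_ge0// exprn_ile1.
Qed.

Lemma moment_le nu k l : (k <= l)%N -> moment nu l <= moment nu k.
Proof.
move=> kl; rewrite /moment !integral_unit; apply: le_mean;
  try exact: bounded_measurable_pow01.
move=> x; rewrite /unit_part !patchE; case: ifPn => // .
by rewrite inE /= in_itv /= => /andP[? ?]; apply: ler_wiXn2l.
Qed.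

End MomentConvergence.
(** * Construction of i.i.d. sequences *)

Section Uniform.
Variable R : realType.
Let idTR : measurableTypeR R -> R := idfun.
#[local] HB.instance Definition _ :=
  @isMeasurableFun.Build _ _ _ _ idTR (@measurable_id _ _ setT).

Lemma exists_uniform01 : exists L : probability R R, forall A, measurable A ->
  L A = lebesgue_measure (A `&` `[0, 1]%classic).
Proof.
(* The image under the identity only changes the carrier from [measurableTypeR R] to [R]. *)
exists (distribution (uniform_prob (@ltr01 R)) idTR) => A mA.
rewrite -[LHS]/(uniform_prob (@ltr01 R) A) /uniform_prob.
rewrite integral_uniform_pdf (eq_integral (cst 1%E)).
  rewrite integral_cst ?mul1e//.
  by apply: measurableI => //; exact: measurable_itv.
move=> x; rewrite inE /= in_itv/= /uniform_pdf => -[_ ->].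
by rewrite subr0 invr1.
Qed.
End Uniform.

Lemma measure_eq_tails (R : realType) (m1 m2 : {measure set R -> \bar R}) :
  (m1 setT < +oo)%E -> (forall t, m1 `]t, +oo[%classic = m2 `]t, +oo[%classic) ->
  forall A, measurable A -> m1 A = m2 A.
Proof.
move=> m1oo tails A mA.
apply: (measure_unique (@RGenOInfty.G R) (fun n => `](- n%:R), +oo[%classic)) => //.
- exact: RGenOInfty.measurableE.
- move=> _ _ [x ->] [y ->]; exists (Num.max x y); apply/seteqP; split => z /=;
    rewrite !in_itv/= !andbT gt_max; [by move=> [-> ->]|by move=> /andP].
- by move=> n; exists (- n%:R).
- rewrite -subTset => x _; exists (Num.trunc `|x|).+1 => //=.
  by rewrite in_itv/= andbT ltrNl (le_lt_trans _ (truncnS_gt _))// ler_normr lexx orbT.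
- by move=> _ [t ->].
- move=> n; rewrite (le_lt_trans _ m1oo)// le_measure// ?inE//; exact: measurable_itv.
Qed.

Section Bits.
Variable R : realType.
Variable L : probability R R.
Hypothesis LE : forall A, measurable A ->
  L A = lebesgue_measure (A `&` `[0, 1]%classic).

Lemma uniform01_tail (t : R) : L `]t, +oo[%classic = (1 - clamp01 t)%:E.
Proof.
rewrite LE; last exact: measurable_itv.
have [t0|t0] := ltP t 0.
  rewrite (_ : _ `&` _ = `[0, 1]%classic); last first.
    apply/seteqP; split => x /=; rewrite !in_itv/= ?andbT; first by case.
    by move=> /andP[x0 x1]; rewrite x0 x1 (lt_le_trans t0).
  rewrite lebesgue_measure_itv/= lte_fin ltr01 -EFinB subr0.
  by rewrite /clamp01 max_l ?subr0// ge_min (ltW t0) orbT.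
rewrite (_ : _ `&` _ = `]t, 1]%classic); last first.
  apply/seteqP; split => x /=; rewrite !in_itv/= ?andbT.
    by move=> [-> /andP[_ ->]].
  by move=> /andP[tx ->]; rewrite tx andbT (le_trans t0)// ltW.
rewrite lebesgue_measure_itv/= lte_fin /clamp01; have [t1|t1] := ltP t 1.
  by rewrite max_r.
by rewrite max_r ?subrr ?ler01.
Qed.

(** On [0, 1], [hi] is the first binary digit and [dbl] shifts the expansion by one place. *)
Definition hi (x : R) : bool := 2^-1 <= x.
Definition dbl (x : R) : R := 2 * x - (hi x)%:R.

Lemma measurable_hi b : measurable [set x | hi x = b].
Proof.
have h : measurable [set x | hi x] by rewrite -[X in measurable X]setTI;
  exact: (@measurable_fun_ler _ _ _ setT).
case: b => //; rewrite (_ : mkset _ = ~` [set x | hi x]); first exact: measurableC.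
by apply/seteqP; split => x /=; [move=> ->|move=> /negP/negbTE].
Qed.

Lemma measurable_dbl : measurable_fun setT dbl.
Proof.
apply: measurable_funB; first exact: measurable_funM.
rewrite (_ : (fun x => _) = \1_[set x | hi x = true]).
  by apply: measurable_indic; exact: measurable_hi.
by apply/funext => x; rewrite indicE; congr (_%:R); congr nat_of_bool;
  apply/idP/idP; rewrite inE.
Qed.

HB.instance Definition _ := @isMeasurableFun.Build _ _ _ _ dbl measurable_dbl.

(** On each half of [0, 1] the map [dbl] is affine with slope 2, so for a half-line B the event is
    an interval; [measure_eq_tails] then reaches every B. Thus the first digit is fair and
    independent of the shifted number, which is again uniform. *)
Lemma uniform01_hi_dbl b (B : set R) : measurable B ->
  L ([set x | hi x = b] `&` dbl @^-1` B) = ((2^-1)%:E * L B)%E.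
Proof.
move=> mB; have h0 : 0 <= 2^-1 :> R by [].
rewrite setIC -[LHS]/(pushforward (mrestr L (measurable_hi b)) dbl B).
rewrite -[RHS]/(mscale (NngNum h0) L B).
move: B mB; apply: measure_eq_tails.
  rewrite -[ltLHS]/(L (setT `&` _)) setTI.
  by rewrite (le_lt_trans (probability_le1 _ (measurable_hi b)))// ltry.
move=> t; rewrite -[RHS]/((2^-1)%:E * L `]t, +oo[%classic)%E uniform01_tail.
rewrite -[LHS]/(L (dbl @^-1` `]t, +oo[%classic `&` [set x | hi x = b])).
rewrite LE; last first.
  apply: measurableI; last exact: measurable_hi.
  by rewrite -[X in measurable X]setTI; apply: measurable_dbl => //; exact: measurable_itv.
rewrite -EFinM /clamp01; case: b.
- have [t0|t0] := ltP t 0.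
    rewrite (_ : _ `&` _ = `[2^-1, 1]%classic); last first.
      apply/seteqP; split => x /=; rewrite /dbl !in_itv/= ?andbT.
        by move=> [[_ x2] /andP[_ ->]]; rewrite andbT; exact: x2.
      move=> /andP[x2 x1]; rewrite /hi x2 x1 /=; split; first split => //; lra.
    rewrite lebesgue_measure_itv/= lte_fin -EFinB.
    rewrite max_l ?subr0; last by rewrite ge_min (ltW t0) orbT.
    by rewrite ifT; [congr EFin; lra|lra].
  rewrite (_ : _ `&` _ = `](t + 1) / 2, 1]%classic); last first.
    apply/seteqP; split => x /=; rewrite /dbl !in_itv/= ?andbT.
      by move=> [[+ hx] /andP[_ ->]]; rewrite hx andbT /=; lra.
    move=> /andP[x2 x1]; have hx : hi x by rewrite /hi; lra.
    by rewrite hx x1 andbT /=; split; first split => //; lra.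
  rewrite lebesgue_measure_itv/= lte_fin -EFinB.
  have [t1|t1] := ltP 1 t.
    by rewrite max_r ?ler01// ifF; [congr EFin; lra|apply/negbTE; rewrite -leNgt; lra].
  rewrite max_r//; case: ifPn => [_|]; first by congr EFin; lra.
  by rewrite -leNgt => ?; congr EFin; lra.
- have [t0|t0] := ltP t 0.
    rewrite (_ : _ `&` _ = `[0, 2^-1[%classic); last first.
      apply/seteqP; split => x /=; rewrite /dbl !in_itv/= ?andbT.
        by move=> [[_ /negbT]] + /andP[-> _]; rewrite /hi -ltNge.
      move=> /andP[x0 x2]; have hx : hi x = false by apply/negbTE; rewrite -ltNge.
      by rewrite hx x0 /=; split; first split => //; lra.
    rewrite lebesgue_measure_itv/= lte_fin -EFinB.
    rewrite max_l ?subr0; last by rewrite ge_min (ltW t0) orbT.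
    by rewrite ifT; [congr EFin; lra|lra].
  rewrite (_ : _ `&` _ = `](t / 2), 2^-1[%classic); last first.
    apply/seteqP; split => x /=; rewrite /dbl !in_itv/= ?andbT.
      move=> [[+ hx] /andP[_ _]]; rewrite hx /= => tx.
      by move: hx => /negbT; rewrite /hi -ltNge => x2; apply/andP; split; lra.
    move=> /andP[x1 x2]; have hx : hi x = false by apply/negbTE; rewrite -ltNge.
    by rewrite hx /=; split; first split => //; lra.
  rewrite lebesgue_measure_itv/= lte_fin -EFinB.
  have [t1|t1] := ltP 1 t.
    by rewrite max_r ?ler01// ifF; [congr EFin; lra|apply/negbTE; rewrite -leNgt; lra].
  rewrite max_r//; case: ifPn => [_|]; first by congr EFin; lra.
  by rewrite -leNgt => ?; congr EFin; lra.
Qed.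

Lemma uniform01_split (S : bool -> set R) : (forall b, measurable (S b)) ->
  L [set x | S (hi x) (dbl x)] = ((2^-1)%:E * (L (S true) + L (S false)))%E.
Proof.
move=> mS; have mb b : measurable ([set x | hi x = b] `&` dbl @^-1` S b).
  apply: measurableI; first exact: measurable_hi.
  by rewrite -[X in measurable X]setTI; exact: measurable_dbl.
rewrite (_ : mkset _ = ([set x | hi x = true] `&` dbl @^-1` S true) `|`
    ([set x | hi x = false] `&` dbl @^-1` S false)); last first.
  apply/seteqP; split => x /=; last by move=> [|] [->].
  by case: (hi x) => h; [left|right].
transitivity (L ([set x | hi x = true] `&` dbl @^-1` S true) +
    L ([set x | hi x = false] `&` dbl @^-1` S false))%E.
  apply: measureU; try exact: mb.
  by apply/seteqP; split => // x [] /= [-> _] [].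
by rewrite !uniform01_hi_dbl// ge0_muleDr ?measure_ge0.
Qed.

(** The binary number formed by the first n digits of even rank of x, ranks being counted from 0. *)
Fixpoint evens n (x : R) : R :=
  if n is n'.+1 then ((hi x)%:R + evens n' (dbl (dbl x))) / 2 else 0.

Lemma evens01 n x : 0 <= evens n x <= 1.
Proof.
elim: n x => [|n IH] x /=; first by rewrite lexx ler01.
by have /andP[? ?] := IH (dbl (dbl x)); case: (hi x) => /=; apply/andP; split; lra.
Qed.

Lemma evens_nondecreasing x : nondecreasing_seq (evens^~ x).
Proof.
apply/nondecreasing_seqP => n; elim: n x => [|n IH] x.
  by have /andP[] := evens01 1 x.
rewrite -[leLHS]/(((hi x)%:R + evens n (dbl (dbl x))) / 2).
rewrite -[leRHS]/(((hi x)%:R + evens n.+1 (dbl (dbl x))) / 2).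
by rewrite ler_pM2r// lerD2l.
Qed.

Lemma measurable_evens n : measurable_fun setT (evens n).
Proof.
elim: n => [|n IH] /=; first exact: measurable_cst.
apply: measurable_funM => //; apply: measurable_funD.
  rewrite (_ : (fun x => _) = \1_[set x | hi x = true]).
    by apply: measurable_indic; exact: measurable_hi.
  by apply/funext => x; rewrite indicE; congr (_%:R); congr nat_of_bool;
    apply/idP/idP; rewrite inE.
apply: (measurableT_comp IH); apply: measurableT_comp; exact: measurable_dbl.
Qed.

(* Upper tail at [s] of the uniform law on the multiples of 2^-n in [0, 1[. *)
Fixpoint dyadic_tail n (s : R) : R :=
  if n is n'.+1 then (dyadic_tail n' (2 * s - 1) + dyadic_tail n' (2 * s)) / 2
  else ((s < 0)%R)%:R.

Lemma clamp01_0 (s : R) : s <= 0 -> clamp01 s = 0.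
Proof. by move=> s0; rewrite /clamp01 max_l// ge_min s0 orbT. Qed.

Lemma clamp01_1 (s : R) : 1 <= s -> clamp01 s = 1.
Proof. by move=> s1; rewrite /clamp01 min_l// max_r. Qed.

(** Reflects the self-similarity of the uniform law, that of (b + U) / 2 for a fair digit b and an
    independent uniform U. It is the recursion of [dyadic_tail], which therefore inherits its bounds
    by induction. *)
Lemma clamp01_rec (s : R) : clamp01 s = (clamp01 (2 * s - 1) + clamp01 (2 * s)) / 2.
Proof.
have [s0|s0] := leP s 0; first by rewrite !clamp01_0; lra.
have [s1|s1] := leP 1 s; first by rewrite !clamp01_1; lra.
have [s2|s2] := leP s 2^-1.
  rewrite [clamp01 (2 * s - 1)]clamp01_0; last lra.
  by rewrite !clamp01_id; first lra; apply/andP; split; lra.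
rewrite [clamp01 (2 * s)]clamp01_1; last lra.
by rewrite !clamp01_id; first lra; apply/andP; split; lra.
Qed.

Lemma dyadic_tail_bounds n s :
  1 - clamp01 (s + 2^-1 ^+ n) <= dyadic_tail n s <= 1 - clamp01 s.
Proof.
elim: n s => [|n IH] s /=.
  rewrite expr0 /clamp01; have [s0|s0] /= := ltP s 0.
    rewrite [Num.max 0 (Num.min 1 s)]max_l; last by rewrite ge_min (ltW s0) orbT.
    by rewrite subr0 lexx andbT gerBl le_max lexx.
  rewrite min_l; last by rewrite lerDr.
  by rewrite max_r// subrr lexx subr_ge0 ge_max ler01 ge_min lexx.
have /andP[h1 h2] := IH (2 * s - 1); have /andP[h3 h4] := IH (2 * s).
rewrite (clamp01_rec s) (clamp01_rec (s + _)).
have e1 : 2 * (s + 2^-1 ^+ n.+1) - 1 = 2 * s - 1 + 2^-1 ^+ n by rewrite exprS; field.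
have e2 : 2 * (s + 2^-1 ^+ n.+1) = 2 * s + 2^-1 ^+ n by rewrite exprS; field.
by rewrite e1 e2; apply/andP; split; lra.
Qed.

(** Each step of the induction reads two digits, one for each of the two numbers, by applying
    [uniform01_split] twice. *)
Lemma uniform01_evens n s t :
  L [set x | s < evens n x /\ t < evens n (dbl x)] =
  (dyadic_tail n s * dyadic_tail n t)%:E.
Proof.
elim: n s t => [|n IH] s t.
  rewrite /=; have [s0|s0] := ltP s 0; have [t0|t0] := ltP t 0;
    rewrite /= ?mulr1 ?mulr0 ?mul0r.
  - rewrite (_ : mkset _ = setT) ?probability_setT//.
    by apply/seteqP; split.
  - by rewrite (_ : mkset _ = set0) ?measure0//; apply/seteqP; split => x // [].
  - by rewrite (_ : mkset _ = set0) ?measure0//; apply/seteqP; split => x // [].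
  - by rewrite (_ : mkset _ = set0) ?measure0//; apply/seteqP; split => x // [].
pose G a c := [set y | 2 * s - (a : bool)%:R < evens n y /\
  2 * t - (c : bool)%:R < evens n (dbl y)].
have mG a c : measurable (G a c).
  apply: measurableI; rewrite -[X in measurable X]setTI;
    apply: (@measurable_fun_ltr _ _ _ setT) => //; first exact: measurable_evens.
  by apply: (measurableT_comp (measurable_evens n)); exact: measurable_dbl.
have mS a : measurable [set y | G a (hi y) (dbl y)].
  rewrite (_ : mkset _ = ([set x | hi x = true] `&` dbl @^-1` G a true) `|`
    ([set x | hi x = false] `&` dbl @^-1` G a false)); last first.
    apply/seteqP; split => x /=; last by move=> [|] [->].
    by case: (hi x) => h; [left|right].
  apply: measurableU; apply: measurableI; try exact: measurable_hi;
    by rewrite -[X in measurable X]setTI; exact: measurable_dbl.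
rewrite (_ : mkset _ = [set x | [set y | G (hi x) (hi y) (dbl y)] (dbl x)]); last first.
  apply/seteqP; split => x /=; rewrite ltr_pdivlMr// ltr_pdivlMr//.
    by move=> [h1 h2]; split; lra.
  by move=> [h1 h2]; split; lra.
rewrite (@uniform01_split (fun a => [set y | G a (hi y) (dbl y)]))//.
have sp a : L [set y | G a (hi y) (dbl y)] =
    ((2^-1)%:E * (L (G a true) + L (G a false)))%E by exact: (@uniform01_split (G a)).
rewrite !sp !IH /= !subr0 -?(EFinD, EFinM).
by congr EFin; field.
Qed.

(* Under the uniform law, the numbers whose binary digits are the digits of even,
   resp. odd, rank of x are independent and uniform.  Splitting the odd part
   again and again produces an i.i.d. sequence. *)
Definition even_bits (x : R) : R := limn (evens^~ x).

Definition odd_bits (x : R) : R := even_bits (dbl x).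

Lemma is_cvg_evens x : cvgn (evens^~ x).
Proof.
apply: nondecreasing_is_cvgn; first exact: evens_nondecreasing.
by exists 1 => _ [n _ <-]; have /andP[] := evens01 n x.
Qed.

Lemma lt_even_bits s x : (s < even_bits x) <-> exists n, s < evens n x.
Proof.
split=> [sx|[n sx]].
  apply: contrapT => /forallNP h; move: sx; rewrite ltNge => /negP; apply.
  apply: limr_le; first exact: is_cvg_evens.
  by apply: nearW => n; rewrite leNgt; exact/negP.
apply: lt_le_trans sx _.
exact: (nondecreasing_cvgn_le (evens_nondecreasing x) (@is_cvg_evens x)).
Qed.

Lemma measurable_even_bits : measurable_fun setT even_bits.
Proof.
apply: (@measurable_fun_cvg _ _ _ _ evens) => [n|x _]; first exact: measurable_evens.
exact: is_cvg_evens.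
Qed.

Lemma measurable_odd_bits : measurable_fun setT odd_bits.
Proof. exact: (measurableT_comp measurable_even_bits measurable_dbl). Qed.

Lemma dyadic_tail_cvg s : dyadic_tail n s @[n --> \oo] --> 1 - clamp01 s.
Proof.
apply: (@squeeze_cvgr _ _ _ _ (fun n => 1 - clamp01 (s + 2^-1 ^+ n))
  (fun=> 1 - clamp01 s)).
- by apply: nearW => n; exact: dyadic_tail_bounds.
- apply: cvgB; first exact: cvg_cst.
  have cc : continuous (@clamp01 R).
    move=> x; apply: continuous_max; first exact: cvg_cst.
    by apply: continuous_min; [exact: cvg_cst|exact: cvg_id].
  apply: (continuous_cvg _ (cc s)); rewrite -[X in _ --> X]addr0; apply: cvgD.
    exact: cvg_cst.
  by apply: cvg_expr; rewrite ger0_norm// invf_lt1// ltr1n.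
- exact: cvg_cst.
Qed.

(** Since [evens] increases to its limit, strict upper tails are increasing unions, and continuity
    from below passes [uniform01_evens] to the limit. *)
Lemma uniform01_bits_tail s t :
  L (even_bits @^-1` `]s, +oo[%classic `&` odd_bits @^-1` `]t, +oo[%classic) =
  (L `]s, +oo[%classic * L `]t, +oo[%classic)%E.
Proof.
pose F n := [set x | s < evens n x /\ t < evens n (dbl x)].
have mF n : measurable (F n).
  apply: measurableI; rewrite -[X in measurable X]setTI;
    apply: (@measurable_fun_ltr _ _ _ setT) => //; first exact: measurable_evens.
  by apply: (measurableT_comp (measurable_evens n)); exact: measurable_dbl.
have ndF : nondecreasing_seq F.
  move=> n m nm; apply/subsetPset => x [h1 h2]; split.
    exact: lt_le_trans h1 (evens_nondecreasing _ nm).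
  exact: lt_le_trans h2 (evens_nondecreasing _ nm).
rewrite (_ : _ `&` _ = \bigcup_n F n); last first.
  apply/seteqP; split => x /=; rewrite !in_itv/= !andbT.
    move=> [/lt_even_bits[n sn] /lt_even_bits[m tm]].
    exists (maxn n m) => //; split.
      exact: lt_le_trans sn (evens_nondecreasing _ (leq_maxl _ _)).
    exact: lt_le_trans tm (evens_nondecreasing _ (leq_maxr _ _)).
  by move=> [n _ [h1 h2]]; split; apply/lt_even_bits; exists n.
have mUF : measurable (\bigcup_n F n) by exact: bigcup_measurable.
have h1 : L (F n) @[n --> \oo] --> L (\bigcup_n F n).
  exact: nondecreasing_cvg_mu.
have h2 : L (F n) @[n --> \oo] --> (L `]s, +oo[%classic * L `]t, +oo[%classic)%E.
  rewrite !uniform01_tail -EFinM; under eq_fun do rewrite uniform01_evens.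
  by apply: cvg_EFin; [exact: nearW|apply: cvgM; exact: dyadic_tail_cvg].
by rewrite -(cvg_lim _ h1)// (cvg_lim _ h2).
Qed.

HB.instance Definition _ :=
  @isMeasurableFun.Build _ _ _ _ even_bits measurable_even_bits.
HB.instance Definition _ :=
  @isMeasurableFun.Build _ _ _ _ odd_bits measurable_odd_bits.

(** Half-lines are extended to Borel sets one coordinate at a time; with the other coordinate
    frozen, both sides are finite measures determined by their tails. *)
Lemma uniform01_bits (A B : set R) : measurable A -> measurable B ->
  L (even_bits @^-1` A `&` odd_bits @^-1` B) = (L A * L B)%E.
Proof.
have mpre (f : {mfun R >-> R}) (D : set R) : measurable D -> measurable (f @^-1` D).
  move=> mD; rewrite -[X in measurable X]setTI.
  exact: (measurable_funPT f measurableT D mD).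
have finL (D : set R) : measurable D -> (fine (L D))%:E = L D.
  by move=> mD; rewrite fineK// fin_num_measure.
have Lge0 (D : set R) : 0 <= fine (L D) by exact: fine_ge0.
have step1 t : forall A, measurable A ->
    L (even_bits @^-1` A `&` odd_bits @^-1` `]t, +oo[%classic) =
    (L A * L `]t, +oo[%classic)%E.
  have mt : measurable (odd_bits @^-1` `]t, +oo[%classic).
    by apply: (mpre odd_bits); exact: measurable_itv.
  move=> {}A mA; rewrite muleC -(finL `]t, +oo[%classic); last exact: measurable_itv.
  rewrite -[LHS]/(pushforward (mrestr L mt) even_bits A).
  rewrite -[RHS]/(mscale (NngNum (Lge0 `]t, +oo[%classic)) L A).
  move: A mA; apply: measure_eq_tails.
    rewrite -[ltLHS]/(L (setT `&` _)) setTI.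
    by rewrite (le_lt_trans (probability_le1 _ mt))// ltry.
  move=> s; rewrite -[LHS]/(L (even_bits @^-1` `]s, +oo[%classic `&` _)).
  rewrite uniform01_bits_tail muleC.
  by rewrite -[RHS]/((fine (L `]t, +oo[%classic))%:E * _)%E finL//; exact: measurable_itv.
move=> mA mB; have mEA := mpre even_bits A mA.
rewrite setIC -(finL A)//.
rewrite -[LHS]/(pushforward (mrestr L mEA) odd_bits B).
rewrite -[RHS]/(mscale (NngNum (Lge0 A)) L B).
move: B mB; apply: measure_eq_tails.
  rewrite -[ltLHS]/(L (setT `&` _)) setTI.
  by rewrite (le_lt_trans (probability_le1 _ mEA))// ltry.
move=> t; rewrite -[LHS]/(L (odd_bits @^-1` `]t, +oo[%classic `&` _)) setIC.
by rewrite step1// -[RHS]/((fine (L A))%:E * _)%E finL.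
Qed.

End Bits.
Section IidSequence.
Context {R : realType}.
Variable L : probability R R.
Hypothesis LE : forall A, measurable A ->
  L A = lebesgue_measure (A `&` `[0, 1]%classic).

Definition iid_uniform (i : nat) (x : R) : R := even_bits (iter i (@odd_bits R) x).

Lemma measurable_iid_uniform i : measurable_fun setT (iid_uniform i).
Proof.
apply: (measurableT_comp (@measurable_even_bits R)).
elim: i => [|i IH] /=; first exact: measurable_id.
exact: (measurableT_comp (@measurable_odd_bits R)).
Qed.

Let mpre (f : R -> R) (B : set R) : measurable_fun setT f -> measurable B ->
  measurable (f @^-1` B).
Proof. by move=> mf mB; rewrite -[X in measurable X]setTI; exact: mf. Qed.

Lemma iid_uniform_prod n (B : nat -> set R) : (forall i, measurable (B i)) ->
  L (\bigcap_(i in [set i | (i < n)%N]) (iid_uniform i @^-1` B i)) =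
  (\prod_(i < n) L (B i))%E.
Proof.
move=> mB; elim: n B mB => [|n IH] B mB.
  rewrite big_ord0 (_ : \bigcap_(i in _) _ = setT) ?probability_setT//.
  by apply/seteqP; split.
rewrite big_ord_recl -(IH (fun i => B i.+1))// -(uniform01_bits LE)//; last first.
  apply: fin_bigcap_measurable => [|i _]; first exact: finite_II.
  by apply: mpre => //; exact: measurable_iid_uniform.
congr (L _); apply/seteqP; split => x.
  move=> h; split; first exact: (h 0%N).
  by move=> i ni; have := h i.+1 ni; rewrite /iid_uniform /= -iterSr.
move=> [h0 h] [_|i ni]; first exact: h0.
by have := h i ni; rewrite /iid_uniform /= -iterSr.
Qed.

Lemma iid_uniform_law i B : measurable B -> L (iid_uniform i @^-1` B) = L B.
Proof.
move=> mB; pose B' j := if j == i then B else setT.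
have mB' j : measurable (B' j) by rewrite /B'; case: ifP.
have := iid_uniform_prod i.+1 mB'; rewrite big_ord_recr/= big1 ?mul1e.
  rewrite {2}/B' eqxx => <-; congr (L _); apply/seteqP; split => x /=.
    by move=> Bx j _; rewrite /B' /=; case: eqVneq => // ->.
  by move=> /(_ i (ltnSn i)); rewrite /B' /= eqxx.
move=> j _; rewrite /B'; case: eqVneq => [ji|_]; last exact: probability_setT.
by move: (ltn_ord j); rewrite ji ltnn.
Qed.

Lemma iid_uniform_independent (s : seq nat) (B : nat -> set R) : uniq s ->
  (forall i, measurable (B i)) ->
  L (\bigcap_(i in [set` s]) (iid_uniform i @^-1` B i)) =
  (\prod_(i <- s) L (B i))%E.
Proof.
move=> us mB; have [n sn] : exists n, forall i, i \in s -> (i < n)%N.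
  exists (\max_(i <- s) i).+1 => i is_; rewrite ltnS.
  exact: (@leq_bigmax_seq _ s xpredT id i is_ isT).
pose B' j := if j \in s then B j else setT.
have mB' j : measurable (B' j) by rewrite /B'; case: ifP.
transitivity (\prod_(i < n) L (B' i))%E.
  rewrite -iid_uniform_prod//; congr (L _); apply/seteqP; split => x /= h i /=.
    by move=> _; rewrite /B'; case: ifPn => // /h.
  by move=> is_; have := h i (sn i is_); rewrite /B' /= is_.
rewrite -(big_mkord xpredT (fun i => L (B' i))) /index_iota subn0.
rewrite (bigID (mem s))/= [X in (_ * X)%E]big1 ?mule1; last first.
  by move=> i nis; rewrite /B' (negbTE nis) probability_setT.
rewrite -big_filter; under eq_big_seq.
  move=> i; rewrite mem_filter /B' => /andP[-> _].
  by over.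
apply: perm_big; apply: uniq_perm => //.
  by rewrite filter_uniq// iota_uniq.
move=> i; rewrite mem_filter mem_iota add0n /=.
by case: (boolP (i \in s)) => // /sn ->.
Qed.

End IidSequence.

(** * The quantile transform *)

Section Quantile.
Context {R : realType}.
Variable nu : probability R R.
Hypothesis nu01 : prob01 nu.

Let tail (x : R) : R := fine (nu `]x, +oo[%classic).

Let tailE x : (tail x)%:E = nu `]x, +oo[%classic.
Proof. by rewrite fineK// fin_num_measure//; exact: measurable_itv. Qed.

Let tail_ge0 x : 0 <= tail x. Proof. exact: fine_ge0. Qed.

Let tail_le1 x : tail x <= 1.
Proof.
by rewrite -lee_fin tailE probability_le1//; exact: measurable_itv.
Qed.

Let tail_nonincreasing x y : x <= y -> tail y <= tail x.
Proof.
move=> xy; rewrite -lee_fin !tailE le_measure ?inE//; try exact: measurable_itv.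
by move=> z /=; rewrite !in_itv/= !andbT; exact: le_lt_trans.
Qed.

Let tail_outside (A : set R) : measurable A -> A `&` `[0, 1]%classic = set0 -> nu A = 0%E.
Proof.
move=> mA A01; have mI : measurable (`[0, 1]%classic : set R) by exact: measurable_itv.
have AC : A `<=` ~` `[0, 1]%classic.
  by move=> x Ax x01; have : (A `&` `[0, 1]%classic) x by []; rewrite A01.
apply/eqP; rewrite eq_le measure_ge0 andbT.
have nC : nu (~` `[0, 1]%classic) = 0%E.
  by rewrite probability_setC// (nu01 : nu _ = 1%E) subee.
by rewrite -nC; apply: le_measure => //; rewrite inE//; exact: measurableC.
Qed.

Let tail_ge1 x : 1 <= x -> tail x = 0.
Proof.
move=> x1; rewrite /tail (tail_outside (measurable_itv _))//.
apply/seteqP; split => // y [] /=; rewrite !in_itv/= andbT => xy /andP[_ y1].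
by move: (lt_le_trans xy y1); rewrite ltNge x1.
Qed.

Let tail_lt0 x : x < 0 -> nu `]x, +oo[%classic = 1%E.
Proof.
move=> x0; apply/eqP; rewrite eq_le probability_le1//=.
rewrite -(nu01 : nu _ = 1%E) le_measure ?inE//; try exact: measurable_itv.
by move=> y /=; rewrite !in_itv/= andbT => /andP[y0 _]; exact: lt_le_trans x0 y0.
Qed.

(** Right continuity of the tail, by continuity of nu from below; it makes [quantile_gt] an
    equivalence between strict inequalities. *)
Let tail_right u x : u < tail x -> exists2 y, x < y & u < tail y.
Proof.
move=> ux; pose F n := `](x + n.+1%:R^-1), +oo[%classic.
have mF n : measurable (F n) by exact: measurable_itv.
have FU : \bigcup_n F n = `]x, +oo[%classic.
  apply/seteqP; split => y /=; rewrite !in_itv/= !andbT.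
    by move=> [n _]; rewrite /F /= in_itv/= andbT; apply: lt_trans; rewrite ltrDl.
  rewrite -subr_gt0 => yx.
  have [n _ /(_ n (leqnn n)) h] := near_infty_natSinv_lt (PosNum yx).
  by exists n => //; rewrite /F /= in_itv/= andbT -ltrBrDl.
have ndF : nondecreasing_seq F.
  move=> n m nm; apply/subsetPset => y; rewrite /F /= !in_itv/= !andbT.
  by apply: le_lt_trans; rewrite lerD2l lef_pV2 ?posrE// ler_nat.
have h1 : nu (F n) @[n --> \oo] --> (tail x)%:E.
  by rewrite tailE -FU; apply: nondecreasing_cvg_mu => //; exact: bigcup_measurable.
have [n _ /(_ n (leqnn n)) un] := cvgr_gt _ (fine_cvg h1) _ ux.
by exists (x + n.+1%:R^-1) => //; rewrite ltrDl.
Qed.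

(* The value 0 and the truncation at 0 of [u] keep the supremum in [0, 1], so that
   the variables of [rde_law] are pointwise in [0, 1]. *)
Definition quantile (u : R) : R :=
  sup [set y | y = 0 \/ 0 < y /\ Num.max 0 u < tail y].

Let quantile_set u := [set y | y = 0 \/ 0 < y /\ Num.max 0 u < tail y].

Let quantile_set_le1 u y : quantile_set u y -> 0 <= y <= 1.
Proof.
move=> [->|[y0 uy]]; first by rewrite lexx ler01.
rewrite (ltW y0) leNgt; apply/negP => /ltW/tail_ge1 y1.
by move: uy; rewrite y1 gt_max ltxx.
Qed.

Let has_sup_quantile u : has_sup (quantile_set u).
Proof.
split; first by exists 0; left.
by exists 1 => y /quantile_set_le1/andP[].
Qed.

Lemma quantile01 u : 0 <= quantile u <= 1.
Proof.
apply/andP; split.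
  by apply: sup_upper_bound; [exact: has_sup_quantile|left].
apply: sup_le_ub => [|y /quantile_set_le1/andP[]//].
by exists 0; left.
Qed.

Lemma quantile_gt u x : 0 <= x -> (x < quantile u) = (Num.max 0 u < tail x).
Proof.
move=> x0; apply/idP/idP.
  move=> /(sup_gt (has_sup_quantile u).1)[y [->|[y0 uy]] xy].
    by move: xy; rewrite ltNge x0.
  by rewrite (lt_le_trans uy)// tail_nonincreasing// ltW.
move=> /tail_right[y xy uy]; apply: (lt_le_trans xy).
apply: sup_upper_bound; first exact: has_sup_quantile.
by right; split => //; exact: le_lt_trans xy.
Qed.

Lemma measurable_quantile : measurable_fun setT quantile.
Proof.
apply: nonincreasing_measurable => // u v uv.
apply: sup_le_ub; first by exists 0; left.
move=> y hy; apply: sup_upper_bound; first exact: has_sup_quantile.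
case: hy => [->|[y0 vy]]; [by left|right; split=> //].
by rewrite (le_lt_trans _ vy)// ge_max !le_max lexx uv !orbT.
Qed.

Lemma quantile_law (L : probability R R) :
  (forall A, measurable A -> L A = lebesgue_measure (A `&` `[0, 1]%classic)) ->
  forall A, measurable A -> L (quantile @^-1` A) = nu A.
Proof.
move=> LE A mA; have mq := measurable_quantile.
pose Q : {mfun R >-> R} := HB.pack quantile (isMeasurableFun.Build _ _ _ _ _ mq).
rewrite -[LHS]/(pushforward L Q A); move: A mA; apply: measure_eq_tails.
  rewrite -[ltLHS]/(L setT).
  by rewrite (le_lt_trans (probability_le1 _ measurableT))// ltry.
move=> t; rewrite -[LHS]/(L (quantile @^-1` `]t, +oo[%classic)).
have mt : measurable (quantile @^-1` `]t, +oo[%classic).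
  by rewrite -[X in measurable X]setTI; exact: (measurable_quantile measurableT (measurable_itv _)).
have [t0|t0] := ltP t 0.
  transitivity (1%E : \bar R); last exact/esym/tail_lt0.
  rewrite (_ : _ @^-1` _ = setT) ?probability_setT//.
  rewrite -subTset => u _ /=; rewrite in_itv/= andbT.
  by have /andP[q0 _] := quantile01 u; exact: lt_le_trans q0.
transitivity ((tail t)%:E); last exact: tailE.
rewrite LE// (_ : _ `&` _ = `[0, tail t[%classic).
  rewrite lebesgue_measure_itv/= lte_fin -EFinB subr0.
  by have := tail_ge0 t; rewrite le_eqVlt => /predU1P[<-|->//]; rewrite ltxx.
apply/seteqP; split => u /=; rewrite !in_itv/= andbT quantile_gt// gt_max.
  by move=> [/andP[_ ->] /andP[-> _]].
move=> /andP[u0 ut]; rewrite ut u0 (le_lt_trans u0 ut)/=; split=> //.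
by rewrite (le_trans (ltW ut)).
Qed.

End Quantile.

(** * The map of the RDE and its action on moments *)

Section RdeMap.
Context {R : realType} d0 (Omega0 : measurableType d0) (P0 : probability Omega0 R)
  (N0 : {RV P0 >-> enat}).
Implicit Types nu : probability R R.

(** On the product of [P0] with the uniform law, N is read from the first coordinate, and the X_i
    are quantiles of the i.i.d. uniform variables extracted from the second. *)
Lemma exists_rde_law nu : prob01 nu -> exists nu', rde_law N0 nu nu'.
Proof.
move=> nu01; have [L LE] := exists_uniform01 R.
pose P := (P0 \x L)%E : probability (Omega0 * R)%type R.
have mq := measurable_quantile nu01.
have mN : measurable_fun setT (fun w : Omega0 * R => N0 w.1).
  exact: (measurableT_comp (measurable_funPT N0) measurable_fst).
have mX0 i : measurable_fun setT (fun x : R => quantile nu (iid_uniform i x)).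
  exact: (measurableT_comp mq (measurable_iid_uniform i)).
have mX i : measurable_fun setT (fun w : Omega0 * R => quantile nu (iid_uniform i w.2)).
  exact: (measurableT_comp (mX0 i) measurable_snd).
have X01 i (w : Omega0 * R) : 0 <= quantile nu (iid_uniform i w.2) <= 1.
  exact: quantile01.
pose N' : {mfun (Omega0 * R)%type >-> enat} :=
  HB.pack (fun w : Omega0 * R => N0 w.1) (isMeasurableFun.Build _ _ _ _ _ mN).
pose X i : {mfun (Omega0 * R)%type >-> R} :=
  HB.pack (fun w : Omega0 * R => quantile nu (iid_uniform i w.2))
    (isMeasurableFun.Build _ _ _ _ _ (mX i)).
have mY : measurable_fun setT
    (fun w : Omega0 * R => 1 - eprod (N' w) (fun i => X i w)).
  by apply: measurable_funB => //; exact: (measurable_eprod mN mX X01).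
pose Y : {mfun (Omega0 * R)%type >-> R} := HB.pack
  (fun w : Omega0 * R => 1 - eprod (N' w) (fun i => X i w))
  (isMeasurableFun.Build _ _ _ _ _ mY).
have PE A B : measurable A -> measurable B -> P (A `*` B) = (P0 A * L B)%E.
  by move=> mA mB; rewrite -[LHS]/((P0 \x L)%E (A `*` B)) product_measure1E.
have PL B : measurable B -> P (snd @^-1` B) = L B.
  move=> mB; rewrite (_ : _ @^-1` _ = setT `*` B); last first.
    by apply/seteqP; split => w //= [].
  by rewrite PE// probability_setT mul1e.
have PP0 A : measurable A -> P (fst @^-1` A) = P0 A.
  move=> mA; rewrite (_ : _ @^-1` _ = A `*` setT); last first.
    by apply/seteqP; split => w //= [].
  by rewrite PE// probability_setT mule1.
have mqB B : measurable B -> measurable (quantile nu @^-1` B).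
  by move=> mB; rewrite -[X in measurable X]setTI; exact: mq.
have mVB i B : measurable B ->
    measurable ((fun x : R => quantile nu (iid_uniform i x)) @^-1` B).
  by move=> mB; rewrite -[X in measurable X]setTI; exact: mX0.
have XL i B : measurable B -> P (X i @^-1` B) = L (quantile nu @^-1` B).
  move=> mB; rewrite -(iid_uniform_law LE i (mqB B mB)).
  by rewrite -[RHS]PL//; exact: mVB.
exists (distribution P Y), _, (Omega0 * R)%type, P, N', X; split=> //.
- move=> A mA; rewrite -[LHS]/(P (fst @^-1` (N0 @^-1` A))) PP0//.
  by rewrite -[X in measurable X]setTI; exact: (measurable_funPT N0).
- by move=> i A mA; rewrite -[LHS]/(P (X i @^-1` A)) XL// (quantile_law nu01 LE).
split.
- move=> J _ E hE.
  have /choice[B hB] : forall i, exists B, measurable B /\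
      (i \in J -> E i = X i @^-1` B).
    move=> i; have [iJ|_] := boolP (i \in J); last by exists setT.
    by have [B mB <-] := hE i iJ; exists B; split=> //; rewrite setTI.
  have mB i : measurable (B i) by have [] := hB i.
  rewrite (_ : \bigcap_(i in _) _ = snd @^-1` (\bigcap_(i in [set` enum_fset J])
      (iid_uniform i @^-1` (quantile nu @^-1` B i)))); last first.
    apply/seteqP; split => w h i /= iJ; have := h i iJ; have [_ /(_ iJ) ->//] := hB i.
  rewrite PL; last first.
    by apply: fin_bigcap_measurable => // i _; exact: mVB.
  rewrite (iid_uniform_independent LE (fset_uniq J)); last by move=> i; exact: mqB.
  apply: eq_big_seq => i iJ; have [_ /(_ iJ) ->] := hB i.
  by rewrite XL.
move=> A B sA [D mD <-]; rewrite setTI.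
(* The events depending on the second coordinate only form a sigma-algebra, and it contains those of
   every X_i. *)
have [A' mA' ->] : exists2 A', measurable A' & A = snd @^-1` A'.
  move: A sA; apply: smallest_sub.
    split; first by exists set0.
      move=> A [A' mA' ->]; exists (~` A'); first exact: measurableC.
      by rewrite setTD.
    move=> F hF.
    have /choice[F' hF'] : forall n, exists A', measurable A' /\ F n = snd @^-1` A'.
      by move=> n; have [A' mA' FA'] := hF n; exists A'.
    exists (\bigcup_n F' n); first by apply: bigcup_measurable => n _; case: (hF' n).
    by rewrite preimage_bigcup; apply: eq_bigcupr => n _; case: (hF' n).
  move=> A [i _ [D' mD' <-]]; rewrite setTI.
  by exists ((fun x : R => quantile nu (iid_uniform i x)) @^-1` D') => //; exact: mVB.
have mND : measurable (N0 @^-1` D).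
  by rewrite -[X in measurable X]setTI; exact: (measurable_funPT N0).
rewrite (_ : _ `&` _ = (N0 @^-1` D) `*` A'); last first.
  by apply/seteqP; split => w //= [].
by rewrite PE// PL// -(PP0 _ mND) muleC.
Qed.

Lemma rde_mapP nu : prob01 nu -> rde_law N0 nu (rde_map N0 nu).
Proof. by move=> /exists_rde_law; exact: xgetPex. Qed.

Lemma prod_iota (F : nat -> R) l : \prod_(i <- iota 0 l) F i = \prod_(i < l) F i.
Proof. by rewrite -[RHS](big_mkord xpredT F) /index_iota subn0. Qed.

Lemma clamp01_pow01 j (x : R) : 0 <= clamp01 x ^+ j <= 1.
Proof. by have /andP[? ?] := clamp01_01 x; rewrite exprn_ge0// exprn_ile1. Qed.

Lemma rde_law_moments nu nu' : rde_law N0 nu nu' ->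
  prob01 nu' /\ forall k, moment nu' k = moment_step (pgf N0) (moment nu) k.
Proof.
case=> d; case=> Omega; case=> P; case=> N; case=> X [NN0 X01 Xnu [indX indXN] nu'E].
have mN := measurable_funPT N; have mX i := measurable_funPT (X i).
have mY : measurable_fun setT (fun w => 1 - eprod (N w) (fun i => X i w)).
  by apply: measurable_funB => //; exact: (measurable_eprod mN mX X01).
pose Y : {mfun Omega >-> R} := HB.pack
  (fun w : Omega => 1 - eprod (N w) (fun i => X i w))
  (isMeasurableFun.Build _ _ _ _ _ mY).
have Y01 w : 0 <= Y w <= 1.
  by have /andP[? ?] := eprod01 (N w) (X01^~ w); apply/andP; split; rewrite /Y /=; lra.
have PY : eq_law (distribution P Y) nu' by move=> A mA; rewrite nu'E.
split.
  rewrite /prob01 /= -PY; last exact: measurable_itv.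
  rewrite -[LHS]/(P (Y @^-1` _)) (_ : _ @^-1` _ = setT) ?probability_setT//.
  by rewrite -subTset => w _; rewrite /preimage /= in_itv/=; exact: Y01.
move=> k; rewrite (moment_distribution k Y01 PY).
transitivity (mean P (fun w => 1 * (1 - eprod (N w) (fun i => X i w)) ^+ k)).
  by apply: eq_mean => w; rewrite mul1r.
rewrite (@mean_rde _ _ _ P _ _ P0 N0 N (fun i => X i) (fun=> 1) 1 (moment nu)) ?mul1r//.
  by move=> j; exact: moment01.
move=> e l j; have mNe : measurable (N @^-1` [set e]) by exact: measurable_value.
have mE : mean P0 \1_(N0 @^-1` [set e]) = mean P \1_(N @^-1` [set e]) :> R.
  apply: EFin_inj; rewrite !mean_indic//; last exact: measurable_value.
  exact/esym/NN0.
have sN : sigma_of N (N @^-1` [set e]) by exists [set e] => //; rewrite setTI.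
have sT : {subset iota 0 l <= [set: nat]} by move=> i _; rewrite inE.
have := mean_prod_independent indX indXN mX sN mNe sT (iota_uniq 0 l)
  (fun=> measurable_funX j (@measurable_clamp01 R)) (fun=> @clamp01_pow01 j).
rewrite mul1r mE prod_iota => h.
transitivity (mean P (fun w => \1_(N @^-1` [set e]) w *
    \prod_(i <- iota 0 l) clamp01 (X i w) ^+ j)).
  apply: eq_mean => w; rewrite mul1r prod_iota; congr (_ * _).
  by apply: eq_bigr => i _; rewrite clamp01_id.
rewrite h; congr (_ * _); rewrite -[l in RHS]card_ord -prodr_const.
apply: eq_bigr => i _; rewrite (moment_distribution j (X01 i) (Xnu i)).
by apply: eq_mean => w; rewrite clamp01_id.
Qed.

Lemma iter_rde_map nu n : prob01 nu -> prob01 (iter n (rde_map N0) nu).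
Proof.
by move=> nu01; elim: n => [//|n IH] /=; case: (rde_law_moments (rde_mapP IH)).
Qed.

Lemma moment_iter_rde_map nu n k : prob01 nu ->
  moment (iter n.+1 (rde_map N0) nu) k =
  moment_step (pgf N0) (moment (iter n (rde_map N0) nu)) k.
Proof.
by move=> nu01; case: (rde_law_moments (rde_mapP (iter_rde_map n nu01))).
Qed.

(** The daughters of the root are independent of each other and of N at the root, and share the law
    of the root, so the recursion has the same moments on both sides. *)
Lemma tree_solution_moments d (Omega : measurableType d) (P : probability Omega R)
    (N : vertex -> {RV P >-> enat}) (C : vertex -> {RV P >-> R}) k :
  iid_copies N N0 -> tree_solution N C ->
  moment (distribution P (C [::])) k =
  moment_step (pgf N0) (moment (distribution P (C [::]))) k.
Proof.
move=> [NN0 _] C_sol; have [C01 Cind Crec Claw] := C_sol.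
have mN := measurable_funPT (N [::]); have mC u := measurable_funPT (C u).
have Cm u j : moment (distribution P (C [::])) j = mean P (fun w => C u w ^+ j).
  exact: moment_distribution (C01 u) (Claw u [::]).
have mprod : measurable_fun setT (fun w => eprod (N [::] w) (fun i => C [:: i] w)).
  by apply: (measurable_eprod mN) => i; [exact: mC|exact: C01].
rewrite [LHS](Cm [::]).
transitivity (mean P (fun w => 1 * (1 - eprod (N [::] w) (fun i => C [:: i] w)) ^+ k)).
  apply: ae_eq_mean; first exact: measurable_funX.
    by apply: measurable_funM => //; apply: measurable_funX; exact: measurable_funB.
  by apply: filterS (Crec [::]) => w ->; rewrite mul1r.
rewrite (@mean_rde _ _ _ P _ _ P0 N0 (N [::]) (fun i => C [:: i]) (fun=> 1) 1
  (moment (distribution P (C [::])))) ?mul1r//.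
  by move=> j; exact: moment01.
move=> e l j; have mNe : measurable (N [::] @^-1` [set e]) by exact: measurable_value.
have mE : mean P0 \1_(N0 @^-1` [set e]) = mean P \1_(N [::] @^-1` [set e]) :> R.
  apply: EFin_inj; rewrite !mean_indic//; last exact: measurable_value.
  exact/esym/(NN0 [::]).
have sN : sigma_family [set v : vertex | (size v < 1)%N]
    (fun v => N v : Omega -> enat) (N [::] @^-1` [set e]).
  exact: sigma_family_preimage.
have [iC iCN] := Cind 1%N.
have sT : {subset children [::] l <= [set u : vertex | size u = 1%N]}.
  by move=> u /size_children us; rewrite inE.
have uc : uniq (children [::] l).
  by have := @uniq_children [::] l [::] isT (fun=> isT); rewrite cats0.
have := mean_prod_independent iC iCN mC sN mNe sT uc
  (fun=> measurable_funX j (@measurable_clamp01 R)) (fun=> @clamp01_pow01 j).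
rewrite mul1r mE (prod_children _ _ (fun u => mean P (fun w => clamp01 (C u w) ^+ j))) => h.
transitivity (mean P (fun w => \1_(N [::] @^-1` [set e]) w *
    \prod_(u <- children [::] l) clamp01 (C u w) ^+ j)).
  apply: eq_mean => w; rewrite mul1r; congr (_ * _).
  rewrite (prod_children _ _ (fun u => clamp01 (C u w) ^+ j)).
  by apply: eq_bigr => i _; rewrite clamp01_id.
rewrite h; congr (_ * _); rewrite -[l in RHS]card_ord -prodr_const.
apply: eq_bigr => i _; rewrite (Cm [:: (i : nat)]).
by apply: eq_mean => w; rewrite clamp01_id.
Qed.

End RdeMap.
(** * Dynamics of the moments *)

Section Contraction.
Context {R : realType}.
Implicit Types e a : nat -> R.

Lemma contraction_cvg0 (q : R) e a : 0 <= q < 1 -> (forall n, 0 <= e n) ->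
  a n @[n --> \oo] --> 0 -> (\forall n \near \oo, e n.+1 <= q * e n + a n) ->
  e n @[n --> \oo] --> 0.
Proof.
move=> /andP[q0 q1] e0 a0 [n0 _ rec]; apply/cvgrPdist_le => eps eps0.
(* With this bound on the perturbation, eps / 2 is the fixed point of x |-> q x + d, which gives the
   invariant [em]. *)
pose d := eps / 2 * (1 - q).
have d0 : 0 < d by rewrite mulr_gt0 ?subr_gt0// divr_gt0.
have /cvgrPdist_le/(_ _ d0)[n1 _ an] := a0.
pose m := maxn n0 n1.
have em k : e (k + m)%N <= eps / 2 + q ^+ k * e m.
  elim: k => [|k IH]; first by rewrite expr0 mul1r lerDr divr_ge0// ltW.
  have km0 : (n0 <= k + m)%N by rewrite (leq_trans (leq_maxl n0 n1))// leq_addl.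
  have km1 : (n1 <= k + m)%N by rewrite (leq_trans (leq_maxr n0 n1))// leq_addl.
  have h1 := rec _ km0; have h2 := an _ km1; rewrite sub0r normrN in h2.
  have {}h2 := le_trans (ler_norm _) h2.
  have h3 : q * e (k + m)%N <= q * (eps / 2 + q ^+ k * e m) by rewrite ler_wpM2l.
  rewrite addSn exprS; apply: (le_trans h1); apply: (le_trans (lerD h3 h2)).
  by rewrite /d le_eqVlt; apply/orP; left; apply/eqP; ring.
have eps20 : 0 < eps / 2 by rewrite divr_gt0.
have : q ^+ k * e m @[k --> \oo] --> 0.
  rewrite -[X in _ --> X](mul0r (e m)); apply: cvgMl.
  by apply: cvg_expr; rewrite ger0_norm.
move=> /cvgrPdist_le/(_ _ eps20)[k0 _ hk].
exists (k0 + m)%N => // n /= nk; rewrite sub0r normrN ger0_norm//.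
have mn : (m <= n)%N by rewrite (leq_trans _ nk)// leq_addl.
have k0n : (k0 <= n - m)%N by rewrite leq_subRL// addnC.
have := hk _ k0n; rewrite sub0r normrN => /(le_trans (ler_norm _)) h.
rewrite -(subnK mn); apply: (le_trans (em _)).
by rewrite [leRHS]splitr lerD2l.
Qed.

Lemma cvg_dist0P e (c : R) :
  `|e n - c| @[n --> \oo] --> 0 <-> e n @[n --> \oo] --> c.
Proof.
split=> [/cvgrPdist_le h|/cvgrPdist_le h]; apply/cvgrPdist_le => eps /h;
  by apply: filterS => n; rewrite sub0r normrN normr_id distrC.
Qed.

End Contraction.

Lemma ltr_eqB (R : realType) (a b x y : R) : b - a = y - x -> a < b -> x < y.
Proof. by move=> e; rewrite -subr_gt0 e subr_gt0. Qed.

Section ConvexDynamics.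
Context {R : realType} (H : R -> R) (mu : R).
Hypothesis H_nd : forall x y : R, 0 <= x -> x <= y -> y <= 1 -> H x <= H y.
Hypothesis H_01 : forall x : R, 0 <= x <= 1 -> 0 <= H x <= 1.
Hypotheses (H_0 : H 0 = 0) (H_1 : H 1 = 1).
(** Strict convexity cleared of quotients, and only below 1, where H may jump. *)
Hypothesis H_chord : forall x y z : R, 0 <= x -> x < y -> y < z -> z < 1 ->
  H y * (z - x) < (z - y) * H x + (y - x) * H z.
Hypotheses (mu01 : 0 < mu < 1) (H_mu : H mu + mu = 1).
Variable r : R.
Hypotheses (r_gt0 : 0 < r)
  (H_slope : forall x, `|x - mu| < r -> `|x - mu| <= `|H x - H mu|)
  (H_slope_left : forall x : R, mu - r < x -> x <= mu -> mu - x <= H mu - H x).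

Let mu0 : 0 < mu. Proof. by case/andP: mu01. Qed.
Let mu1 : mu < 1. Proof. by case/andP: mu01. Qed.

Lemma root_unique (x : R) : 0 <= x <= 1 -> H x + x = 1 -> x = mu.
Proof.
move=> /andP[x0 x1] Hx; apply/eqP; case: (ltgtP x mu) => // xmu.
  by have h := H_nd x0 (ltW xmu) (ltW mu1); exfalso; move: H_mu; lra.
by have h := H_nd (ltW mu0) (ltW xmu) x1; exfalso; move: H_mu; lra.
Qed.

(** As H 0 = 0, the chord from 0 gives H x < (x / y) H y for 0 < x < y, and this is below H y
    because H y > 0, by the same chord at y / 2. *)
Lemma H_increasing (x y : R) : 0 <= x -> x < y -> y < 1 -> H x < H y.
Proof.
move=> x0 xy y1; have y0 := le_lt_trans x0 xy.
have Hy0 : 0 < H y.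
  have y20 : 0 < y / 2 by rewrite divr_gt0.
  have y2y : y / 2 < y by rewrite ltr_pdivrMr// mulr_natr mulr2n ltrDl.
  have := H_chord (lexx 0) y20 y2y y1; rewrite H_0 mulr0 add0r !subr0.
  have y2_01 : 0 <= y / 2 <= 1 by rewrite (ltW y20) ltW// (lt_trans y2y).
  have /andP[h _] := H_01 y2_01.
  by move=> h'; rewrite -(pmulr_rgt0 _ y20); apply: le_lt_trans h'; rewrite mulr_ge0// ltW.
move: x0; rewrite le_eqVlt => /predU1P[<-|x0]; first by rewrite H_0.
have := H_chord (lexx 0) x0 xy y1; rewrite H_0 mulr0 add0r !subr0 => h.
rewrite -(ltr_pM2r y0); apply: (lt_trans h).
by rewrite mulrC ltr_pM2l.
Qed.

Lemma H_inj_mu (x : R) : 0 <= x <= 1 -> H x = H mu -> x = mu.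
Proof.
move=> /andP[x0 x1] Hx; apply/eqP; case: (ltgtP x mu) => // xmu.
  by have := H_increasing x0 xmu mu1; rewrite Hx ltxx.
move: x1; rewrite le_eqVlt => /predU1P[x1|x1].
  by have := H_mu; rewrite -Hx x1 H_1 => h; exfalso; move: mu0 h; lra.
by have := H_increasing (ltW mu0) xmu x1; rewrite Hx ltxx.
Qed.

(** Once the orbit stays within r of mu its distance to mu cannot decrease, so convergence forces
    this distance to be 0; [H_inj_mu] then carries the equality back to time 0. *)
Lemma repelling (m : nat -> R) : (forall n, 0 <= m n <= 1) ->
  (forall n, m n.+1 = 1 - H (m n)) -> m n @[n --> \oo] --> mu -> m 0%N = mu.
Proof.
move=> m01 rec mmu.
have back n : m n = mu -> m 0%N = mu.
  elim: n => // n IH; rewrite rec => h; apply: IH; apply: H_inj_mu => //.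
  by move: H_mu h; lra.
have /cvgrPdist_lt/(_ _ r_gt0)[n0 _ hn] := mmu.
have grow k : `|m n0 - mu| <= `|m (k + n0)%N - mu|.
  elim: k => // k IH; apply: (le_trans IH); rewrite addSn rec.
  have -> : 1 - H (m (k + n0)%N) - mu = - (H (m (k + n0)%N) - H mu).
    by move: H_mu; lra.
  by rewrite normrN; apply: H_slope; rewrite distrC; apply: hn; exact: leq_addl.
apply: (back n0); apply/eqP; rewrite -subr_eq0 -normr_le0; apply/ler_addgt0Pr => e e0.
have /cvgrPdist_lt/(_ _ e0)[n1 _ hn1] := mmu.
rewrite add0r (le_trans (grow n1))// distrC ltW//; apply: hn1; exact: leq_addr.
Qed.

(** Supplies the bound on the second moments of [truncated]: they start at mu^2, and the last
    inequality keeps them below b. It holds just to the left of mu, where H b <= H mu - (mu - b). *)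
Lemma exists_subfixed : exists2 b, mu ^+ 2 <= b < mu & 2 * mu - 1 + H b <= b.
Proof.
exists (Num.max (mu ^+ 2) (mu - r / 2)).
  rewrite le_max lexx/= gt_max expr2 gtr_pMr// mu1/=.
  by rewrite ltrBlDr ltrDl divr_gt0.
set b := Num.max _ _; have bmu : b <= mu.
  by rewrite ge_max expr2 ger_pMr// (ltW mu1)/= lerBlDr lerDl divr_ge0// ltW.
have := H_slope_left _ bmu; have rb : mu - r < b.
  by rewrite lt_max; apply/orP; right; move: r_gt0; lra.
by move=> /(_ rb); move: H_mu; lra.
Qed.

Variable c : R.
Hypotheses (c0 : 0 <= c) (c_mu : c < mu) (c_fix : c = 2 * mu - 1 + H c).

Let chordE (z : R) : c < z -> z < mu -> H z - H c < z - c.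
Proof.
move=> cz zmu; have h := H_chord c0 cz zmu mu1.
have hm : H mu - H c = mu - c by move: H_mu c_fix; lra.
have mc : 0 < mu - c by lra.
rewrite -(ltr_pM2r mc).
have e1 : H mu = H c + (mu - c) by lra.
by rewrite e1 in h; apply: ltr_eqB h; ring.
Qed.

(* The chord of the convex map x |-> 2 mu - 1 + H x above [c, z] has slope less
   than 1 when c < z < mu, and it controls the distance to c on all of [0, z]. *)
Lemma second_moment_cvg (u : nat -> R) : (forall n, 0 <= u n <= 1) ->
  u 0%N < mu -> (forall n, u n.+1 = 2 * mu - 1 + H (u n)) ->
  u n @[n --> \oo] --> c.
Proof.
move=> u01 u0mu rec; pose z := Num.max (u 0%N) ((c + mu) / 2).
have zmu : z < mu by rewrite gt_max u0mu/=; move: c_mu; lra.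
have cz : c < z by rewrite lt_max; apply/orP; right; move: c_mu; lra.
have zc0 : 0 < z - c by rewrite subr_gt0.
have z1 : z < 1 := lt_trans zmu mu1.
have uz n : u n <= z.
  elim: n => [|n IH]; first by rewrite le_max lexx.
  have /andP[un0 _] := u01 n.
  have := H_nd un0 IH (ltW z1); have := chordE cz zmu; rewrite rec.
  by move: c_fix; lra.
pose q := (H z - H c) / (z - c).
have q01 : 0 <= q < 1.
  apply/andP; split; last by rewrite ltr_pdivrMr// mul1r chordE.
  by apply: divr_ge0; rewrite subr_ge0; [exact: H_nd c0 (ltW cz) (ltW z1)|exact: ltW].
have qz : q * (z - c) = H z - H c by rewrite /q divfK// gt_eqF.
have lip (x : R) : 0 <= x -> x <= z -> `|H x - H c| <= q * `|x - c|.
  move=> x0 xz; case: (ltgtP x c) => [xc|cx|->]; last by rewrite !subrr normr0 mulr0.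
  - have h := H_chord x0 xc cz z1.
    have Hxc := H_nd x0 (ltW xc) (ltW (lt_trans c_mu mu1)).
    rewrite !ler0_norm ?subr_le0 ?(ltW xc)//.
    rewrite !opprB -(ler_pM2r zc0) mulrAC qz ltW//.
    by apply: ltr_eqB h; ring.
  - have Hcx := H_nd c0 (ltW cx) (le_trans xz (ltW z1)).
    rewrite !ger0_norm ?subr_ge0 ?(ltW cx)//.
    move: xz; rewrite le_eqVlt => /predU1P[->|xz]; first by rewrite qz.
    have h := H_chord c0 cx xz z1.
    rewrite -(ler_pM2r zc0) mulrAC qz ltW//.
    by apply: ltr_eqB h; ring.
apply/cvg_dist0P; apply: (contraction_cvg0 q01 _ (a := fun=> 0)) => //.
  exact: cvg_cst.
apply: nearW => n; rewrite addr0; have /andP[un0 _] := u01 n.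
have -> : u n.+1 - c = H (u n) - H c by rewrite rec; move: c_fix; lra.
exact: lip.
Qed.

(** By convexity the slopes of H on [0, y] are at most the slope L of its chord above [y, z].
    Placing y beyond c by half of the slack z - c - (H z - H c) keeps L < 1, since H z - H y <= H z
    - H c < z - y. *)
Lemma lipschitz_near : exists y L, [/\ c < y, 0 <= L < 1 &
  forall s t : R, 0 <= s <= y -> 0 <= t <= y -> `|H s - H t| <= L * `|s - t|].
Proof.
pose z := (c + mu) / 2.
have cz : c < z by rewrite /z; move: c_mu; lra.
have zmu : z < mu by rewrite /z; move: c_mu; lra.
have z1 := lt_trans zmu mu1.
have hz := chordE cz zmu.
pose y := c + (z - c - (H z - H c)) / 2.
have cy : c < y by rewrite /y; lra.
have Hcz : H c <= H z by exact: H_nd c0 (ltW cz) (ltW z1).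
have yz : y < z by rewrite /y; lra.
have zy0 : 0 < z - y by rewrite subr_gt0.
have y0 : 0 <= y by rewrite (le_trans c0)// ltW.
pose L := (H z - H y) / (z - y).
have Lzy : L * (z - y) = H z - H y by rewrite /L divfK// gt_eqF.
exists y, L; split=> //.
  apply/andP; split.
    apply: divr_ge0; last exact: ltW.
    by rewrite subr_ge0; apply: H_nd => //; exact: ltW.
  rewrite ltr_pdivrMr// mul1r.
  by have := H_nd c0 (ltW cy) (ltW (lt_trans yz z1)); rewrite /y; lra.
have slopeL (t : R) : 0 <= t -> t <= y -> (H z - H t) * (z - y) <= (H z - H y) * (z - t).
  move=> t0; rewrite le_eqVlt => /predU1P[->//|ty]; rewrite ltW//.
  by apply: ltr_eqB (H_chord t0 ty yz z1); ring.
have main (s t : R) : 0 <= s -> s < t -> t <= y -> H t - H s <= L * (t - s).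
  move=> s0 st ty; have tz := le_lt_trans ty yz.
  have t0 : 0 <= t by rewrite (le_trans s0)// ltW.
  have zt0 : 0 < z - t by rewrite subr_gt0.
  have ts0 : 0 < t - s by rewrite subr_gt0.
  have h1 : (H t - H s) * (z - t) <= (H z - H t) * (t - s).
    by rewrite ltW//; apply: ltr_eqB (H_chord s0 st tz z1); ring.
  have h2 : H z - H t <= L * (z - t).
    rewrite -(ler_pM2r zy0) mulrAC Lzy; exact: slopeL.
  rewrite -(ler_pM2r zt0) (le_trans h1)// mulrAC; apply: ler_wpM2r => //; exact: ltW.
move=> s t /andP[s0 sy] /andP[t0 ty].
wlog st : s t s0 sy t0 ty / s <= t.
  move=> wl; have [st|/ltW ts] := leP s t; first exact: wl.
  by rewrite (distrC (H s)) (distrC s); exact: wl.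
have t1 : t <= 1 by rewrite (le_trans ty)// ltW// (lt_trans yz).
have Hst := H_nd s0 st t1.
rewrite (distrC (H s)) (distrC s) !ger0_norm ?subr_ge0//.
move: st; rewrite le_eqVlt => /predU1P[->|st]; first by rewrite !subrr mulr0.
exact: main.
Qed.

End ConvexDynamics.
Section MomentStepFacts.
Context {R : realType} (H : R -> R).

Lemma moment_step_recr m k : moment_step H m k =
  \sum_(j < k) ((-1) ^+ j *+ 'C(k, j)) * H (m j) + (-1) ^+ k * H (m k).
Proof.
rewrite /moment_step big_ord_recr/= binn mulr1n; congr (_ + _).
by apply: eq_bigr => j _; rewrite mulrnAl.
Qed.

Lemma moment_step0 m : moment_step H m 0 = H (m 0%N).
Proof. by rewrite moment_step_recr big_ord0 add0r expr0 mul1r. Qed.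

Lemma moment_step1 m : moment_step H m 1 = H (m 0%N) - H (m 1%N).
Proof. by rewrite moment_step_recr big_ord1 expr0 bin0 mulr1n mul1r expr1 mulN1r. Qed.

Lemma moment_step2 m :
  moment_step H m 2 = H (m 0%N) - 2 * H (m 1%N) + H (m 2%N).
Proof.
rewrite moment_step_recr big_ord_recr big_ord1 /= bin0 bin1 !expr0 expr1 mulr1n.
by rewrite mul1r mulNrn mulNr sqrrN expr1n mul1r.
Qed.

(** At order k the step involves the k-th moment only through one term, plus or minus its image
    under H. The other terms converge by induction, so the distance to the limit obeys a contraction
    with a vanishing perturbation. *)
Lemma moments_cvg (L y : R) (M : nat -> nat -> R) (c : nat -> R) :
  0 <= L < 1 ->
  (forall s t, 0 <= s <= y -> 0 <= t <= y -> `|H s - H t| <= L * `|s - t|) ->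
  (forall n k, M n.+1 k = moment_step H (M n) k) ->
  (forall k, c k = moment_step H c k) ->
  (forall n k, 0 <= M n k) -> (forall k, 0 <= c k) ->
  (forall n k, (2 <= k)%N -> M n k <= M n 2%N) ->
  (forall k, (2 <= k)%N -> c k <= c 2%N) ->
  (forall n, M n 0%N = c 0%N) -> (forall n, M n 1%N = c 1%N) ->
  c 2%N < y -> M n 2%N @[n --> \oo] --> c 2%N ->
  forall k, M n k @[n --> \oo] --> c k.
Proof.
move=> L01 lip Mrec crec M0 c0 M2 c2 Mc0 Mc1 cy Mc2.
have near_y : \forall n \near \oo, M n 2%N <= y.
  by have := cvgr_le _ Mc2 _ cy; apply.
have near_lip k : (2 <= k)%N -> \forall n \near \oo,
    `|H (M n k) - H (c k)| <= L * `|M n k - c k|.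
  move=> k2; apply: filterS near_y => n My; apply: lip.
    by rewrite M0 (le_trans (M2 n k k2)).
  by rewrite c0 (le_trans (c2 k k2))// ltW.
have HM k : M n k @[n --> \oo] --> c k -> H (M n k) @[n --> \oo] --> H (c k).
  case: k => [|[|k]] Mc.
  - by under eq_fun do rewrite Mc0; exact: cvg_cst.
  - by under eq_fun do rewrite Mc1; exact: cvg_cst.
  apply/cvg_dist0P.
  apply: (@squeeze_cvgr _ _ _ _ (fun=> 0) (fun n => L * `|M n k.+2 - c k.+2|)).
  - by apply: filterS (near_lip k.+2 isT) => n ->; rewrite normr_ge0.
  - exact: cvg_cst.
  - by rewrite -[X in _ --> X](mulr0 L); apply: cvgMr; apply/cvg_dist0P.
elim/ltn_ind => -[|[|[|k]]] IH //.
- by under eq_fun do rewrite Mc0; exact: cvg_cst.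
- by under eq_fun do rewrite Mc1; exact: cvg_cst.
set K := k.+3 in IH *.
pose T (m : nat -> R) := \sum_(j < K) ((-1) ^+ j *+ 'C(K, j)) * H (m j).
have TM : T (M n) @[n --> \oo] --> T c.
  by apply: cvg_sum_seq => j; apply: cvgMr; apply: HM; apply: IH; exact: ltn_ord.
apply/cvg_dist0P; apply: (contraction_cvg0 L01 _ (a := fun n => `|T (M n) - T c|)).
- by move=> n; exact: normr_ge0.
- exact/cvg_dist0P.
apply: filterS (near_lip K isT) => n h.
rewrite Mrec {1}(crec K) !moment_step_recr -/(T (M n)) -/(T c) opprD addrACA -mulrBr.
rewrite [leRHS]addrC (le_trans (ler_normD _ _))//.
by rewrite lerD2l normrM normrX normrN1 expr1n mul1r.
Qed.

End MomentStepFacts.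

(** * The generating function H *)

Section GeneratingFunction.
Context {R : realType} d0 (Omega0 : measurableType d0) (P0 : probability Omega0 R)
  (N0 : {RV P0 >-> enat}).

Lemma epow01 (s : R) e : 0 <= s <= 1 -> 0 <= epow s e <= 1.
Proof. by move=> s01; rewrite -eprod_cst//; exact: eprod01. Qed.

Lemma bounded_measurable_epow (s : R) : 0 <= s <= 1 ->
  bounded_measurable (fun w => epow s (N0 w)).
Proof.
move=> s01; under eq_fun do rewrite -eprod_cst//.
apply: bounded_measurable01 => [|w]; last exact: eprod01.
exact: (@measurable_eprod _ _ _ N0 (fun _ _ => s)).
Qed.

Lemma pgf_nondecreasing (s t : R) : 0 <= s -> s <= t -> t <= 1 ->
  pgf N0 s <= pgf N0 t.
Proof.
move=> s0 st t1; have t0 := le_trans s0 st; have s1 := le_trans st t1.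
apply: (@le_mean _ _ _ P0) => [||w]; try by apply: bounded_measurable_epow; apply/andP.
case: (N0 w) => [k|] /=; first by apply: lerXn2r; rewrite ?nnegrE.
have [se|_] := eqVneq s 1; last by case: (t == 1); rewrite ?ler01.
have -> : t = 1 by apply: le_anti; rewrite t1 /= -se.
by rewrite eqxx.
Qed.

Lemma pgf01 (s : R) : 0 <= s <= 1 -> 0 <= pgf N0 s <= 1.
Proof.
move=> s01; apply: (@mean01P _ _ _ P0); first by case: (bounded_measurable_epow s01).
by move=> w; exact: epow01.
Qed.

Lemma pgf1 : pgf N0 1 = 1.
Proof.
rewrite -[RHS](mean_cst P0); apply: eq_mean => w.
by case: (N0 w) => [k|] /=; rewrite ?expr1n ?eqxx.
Qed.

Lemma pgf0 : (forall w, N0 w <> Some 0%N) -> pgf N0 0 = 0 :> R.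
Proof.
move=> Npos; rewrite -[RHS](mean_cst P0); apply: eq_mean => w.
have := Npos w; case: (N0 w) => [[|k]|] //= _; first by rewrite expr0n.
by rewrite eq_sym oner_eq0.
Qed.

Lemma pgf_chord (x y z : R) : strictly_convex_on `[0, 1[ (pgf N0) ->
  0 <= x -> x < y -> y < z -> z < 1 ->
  pgf N0 y * (z - x) < (z - y) * pgf N0 x + (y - x) * pgf N0 z.
Proof.
move=> cvx x0 xy yz z1.
have xz : 0 < z - x by rewrite subr_gt0 (lt_trans xy).
have Dx : `[0, 1[%classic x by rewrite /= in_itv/= x0 (lt_trans xy)// (lt_trans yz).
have Dz : `[0, 1[%classic z.
  by rewrite /= in_itv/= z1 andbT (le_trans x0)// ltW// (lt_trans xy).
have xnz : x != z by rewrite lt_eqF// (lt_trans xy).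
have t01 : 0 < (z - y) / (z - x) < 1.
  apply/andP; split; first by rewrite divr_gt0// subr_gt0.
  by rewrite ltr_pdivrMr// mul1r ltrD2l ltrN2.
have := cvx x z _ Dx Dz xnz t01.
have -> : (z - y) / (z - x) * x + (1 - (z - y) / (z - x)) * z = y.
  by field; rewrite gt_eqF.
rewrite -(ltr_pM2r xz) => h; apply: (lt_le_trans h); rewrite le_eqVlt.
by apply/orP; left; apply/eqP; field; rewrite gt_eqF.
Qed.

End GeneratingFunction.

(* [derive1] is 0 when the limit does not exist, so [1 < derive1 f a] entails
   differentiability. *)
Lemma derive1_gt1_slope (R : realType) (f : R -> R) (a : R) : 1 < derive1 f a ->
  exists2 r : R, 0 < r &
  (forall x, `|x - a| < r -> `|x - a| <= `|f x - f a|) /\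
  (forall x, a - r < x -> x <= a -> a - x <= f a - f x).
Proof.
move=> fa; have cf : cvg ((fun h => h^-1 *: (f (h + a) - f a)) @ 0^').
  apply: contrapT => /dvgP dv; move: fa; rewrite /derive1 dv.
  by rewrite -[point]/(0 : R) ltNge ler01.
have : \forall h \near 0^', 1 < h^-1 *: (f (h + a) - f a).
  by have := cvgr_gt _ cf _ fa; apply.
rewrite near_withinE => /nbhs_ballP[r /= r0 hr].
have slope x : `|x - a| < r -> x != a -> 1 < (x - a)^-1 * (f x - f a).
  move=> xr xa; have := hr (x - a); rewrite /= subrK; apply; last by rewrite subr_eq0.
  by rewrite /ball /= sub0r normrN.
have right x : `|x - a| < r -> a < x -> x - a <= f x - f a.
  move=> xr ax; have := slope x xr; rewrite gt_eqF// => /(_ isT).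
  by rewrite mulrC ltr_pdivlMr ?subr_gt0// mul1r => /ltW.
have left x : `|x - a| < r -> x < a -> a - x <= f a - f x.
  move=> xr xa; have := slope x xr; rewrite lt_eqF// => /(_ isT).
  rewrite -[(x - a)^-1 * _]mulrNN -invrN !opprB mulrC.
  by rewrite ltr_pdivlMr ?subr_gt0// mul1r => /ltW.
exists r => //; split=> x.
  case: (ltgtP x a) => [xa|ax|->] xr; last by rewrite !subrr.
    by rewrite distrC [leRHS]distrC (le_trans _ (ler_norm _))// ger0_norm ?left// subr_ge0 ltW.
  by rewrite (le_trans _ (ler_norm _))// ger0_norm ?right// subr_ge0 ltW.
move=> xr; rewrite le_eqVlt => /predU1P[->|xa]; first by rewrite !subrr.
by apply: left => //; rewrite distrC ger0_norm ?subr_ge0 ?(ltW xa)// ltrBlDr -ltrBlDl.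
Qed.

(** * Laws carried by {0, 1} *)

Section TwoPoint.
Context {R : realType}.
Implicit Types nu : probability R R.

Let m01 : measurable [set 0; 1 : R].
Proof. by apply: measurableU; exact: measurable_set1. Qed.

Lemma two_point_ae nu : nu [set 0; 1] = 1%E -> {ae nu, forall x, [set 0; 1] x}.
Proof.
move=> nu1; exists (~` [set 0; 1]); split => //; first exact: measurableC.
by rewrite probability_setC// nu1 subee.
Qed.

Lemma two_point_law nu A : nu [set 0; 1] = 1%E -> measurable A ->
  fine (nu A) = (1 - mean01 nu) * \1_A 0 + mean01 nu * \1_A 1.
Proof.
move=> nu1 mA; have ae01 := two_point_ae nu1.
have m1 : mean01 nu = mean nu \1_[set 1].
  rewrite /mean01 integral_unit; apply: ae_eq_mean.
  - by have [] := @bounded_measurable_pow01 R 1.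
  - by apply: measurable_indic; exact: measurable_set1.
  apply: filterS ae01 => x [] -> /=;
    rewrite /unit_part patchE indicE mem_set/= ?in_itv/= ?lexx ?ler01//.
    by rewrite memNset//= => /esym/eqP; rewrite oner_eq0.
  by rewrite mem_set.
have bi (B : set R) : measurable B -> bounded_measurable (\1_B : R -> R).
  by move=> mB; exact: bounded_measurable_indic.
have b1 : bounded_measurable (\1_[set (1 : R)] : R -> R) by apply: bi; exact: measurable_set1.
rewrite -mean_indicE//.
have bB := bounded_measurableB (bounded_measurable_cst _ 1) b1.
transitivity (mean nu (fun x => \1_A 0 * (1 - \1_[set 1] x) + \1_A 1 * \1_[set 1] x)).
  apply: ae_eq_mean.
  - exact: measurable_indic.
  - by apply: (bounded_measurableD _ _).1; exact: bounded_measurableZ.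
  apply: filterS ae01 => x [] ->.
    rewrite (_ : \1_[set 1] 0 = 0) ?subr0 ?mulr1 ?mulr0 ?addr0//.
    by rewrite indicE memNset//= => /esym/eqP; rewrite oner_eq0.
  by rewrite (_ : \1_[set 1] 1 = 1) ?subrr ?mulr1 ?mulr0 ?add0r// indicE mem_set.
rewrite meanD; try exact: bounded_measurableZ.
by rewrite !meanZ// meanB// mean_cst -m1 mulrC [_ * mean01 nu]mulrC.
Qed.

Lemma two_point_moment nu k : nu [set 0; 1] = 1%E -> moment nu k.+1 = mean01 nu.
Proof.
move=> /two_point_ae ae01; rewrite -moment1 /moment !integral_unit.
apply: ae_eq_mean.
- by have [] := @bounded_measurable_pow01 R k.+1.
- by have [] := @bounded_measurable_pow01 R 1.
apply: filterS ae01 => x [] ->; rewrite /unit_part !patchE.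
  by case: ifP; rewrite // !expr0n.
by case: ifP; rewrite // !expr1n.
Qed.

(** The function x (1 - x) is nonnegative on [0, 1] and has mean 0, so it vanishes almost
    everywhere. *)
Lemma moment_eq_two_point nu : prob01 nu -> moment nu 2 = moment nu 1 ->
  nu [set 0; 1] = 1%E.
Proof.
move=> nu01 m21.
pose g := unit_part (fun x : R => x * (1 - x)).
have cg : {within `[0, 1], continuous (fun x : R => x * (1 - x))}.
  apply: continuous_within01 => x; apply: cvgM; first exact: cvg_id.
  by apply: cvgB; [exact: cvg_cst|exact: cvg_id].
have bg := bounded_measurable_unit cg.
have g0 x : 0 <= g x.
  rewrite /g /unit_part patchE; case: ifPn => // .
  by rewrite inE /= in_itv/= => /andP[x0 x1]; rewrite mulr_ge0// subr_ge0.
have mg : mean nu g = 0.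
  have := m21; rewrite /moment !integral_unit => h.
  rewrite -(subrr (mean nu (unit_part (fun x => x ^+ 1)))) -{2}h -meanB;
    try exact: bounded_measurable_pow01.
  apply: eq_mean => x; rewrite /g /unit_part !patchE; case: ifPn => _; last by rewrite subrr.
  by rewrite expr1 expr2 mulrBr mulr1.
have : {ae nu, forall x, g x = 0}.
  have mEg : measurable_fun setT (EFin \o g) by apply/measurable_EFinP; case: bg.
  have /(ae_eq_integral_abs nu measurableT mEg).1 :
      (\int[nu]_(x in setT) `|(EFin \o g) x| = 0)%E.
    under eq_integral do rewrite /= ger0_norm//.
    rewrite -[LHS]fineK; last first.
      exact/integrable_fin_num/(bounded_measurable_integrable nu bg).
    by congr EFin; exact: mg.
  by apply: filterS => x /(_ I) /= [].
move=> [Z [mZ Z0 gZ]].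
have sub : `[0, 1]%classic `<=` [set 0; 1] `|` Z.
  move=> x x01; have [Zx|nZx] := pselect (Z x); [by right|left].
  have : g x = 0 by apply: contrapT => gx; apply: nZx; exact: gZ.
  rewrite /g /unit_part patchE mem_set// => /eqP; rewrite mulf_eq0 subr_eq0.
  by move=> /orP[/eqP ->|/eqP <-]; [left|right].
apply/eqP; rewrite eq_le probability_le1//=.
rewrite -(nu01 : nu _ = 1%E).
have := le_measure nu _ _ sub; rewrite !inE => /(_ (measurable_itv _) (measurableU _ _ m01 mZ)).
set S := [set 0; 1] in sub *; set SZ := S `|` Z in sub *.
have h : (nu SZ <= nu S + nu Z)%E by exact: measureU2.
by rewrite Z0 adde0 in h => /le_trans; exact.
Qed.

Lemma eq_two_point_law nu (delta : probability R R) : prob01 nu -> delta [set 0; 1] = 1%E ->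
  mean01 nu = mean01 delta -> moment nu 2 = moment nu 1 -> eq_law nu delta.
Proof.
move=> nu01 d1 md m21 A mA; have n1 := moment_eq_two_point nu01 m21.
rewrite -[LHS]fineK ?fin_num_measure// -[RHS]fineK ?fin_num_measure//.
by rewrite !two_point_law// md.
Qed.

End TwoPoint.

Theorem theorem5p3 (R : realType)
    (d0 : measure_display) (Omega0 : measurableType d0)
    (P0 : probability Omega0 R) (N0 : {RV P0 >-> enat})
    (N0_pos : forall w, N0 w <> Some 0%N)
    (H_convex : strictly_convex_on `[0, 1[ (pgf N0))
    (mu1 : R) (mu1_01 : 0 < mu1 < 1) (mu1_root : pgf N0 mu1 + mu1 = 1)
    (H'_gt1 : 1 < derive1 (pgf N0) mu1)
    (delta : probability R R)
    (delta_supp : delta [set 0; 1] = 1%E) (delta_mean : mean01 delta = mu1)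
    (d : measure_display) (Omega : measurableType d)
    (P : probability Omega R) (N : vertex -> {RV P >-> enat})
    (N_iid : iid_copies N N0)
    (C : vertex -> {RV P >-> R})
    (C_sol : tree_solution N C) (C_endo : endogenous N C) :
  basin N0 (distribution P (C [::])) =
  [set nu : probability R R |
    prob01 nu /\ mean01 nu = mu1 /\ ~ eq_law nu delta].
Proof.
have [r r0 [Hslope Hleft]] := derive1_gt1_slope H'_gt1.
pose H := pgf N0.
have Hnd (x y : R) : 0 <= x -> x <= y -> y <= 1 -> H x <= H y by exact: pgf_nondecreasing.
have H01 (x : R) : 0 <= x <= 1 -> 0 <= H x <= 1 by exact: pgf01.
have H0 : H 0 = 0 by exact: pgf0.
have H1 : H 1 = 1 by exact: pgf1.
have Hc (x y z : R) : 0 <= x -> x < y -> y < z -> z < 1 ->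
    H y * (z - x) < (z - y) * H x + (y - x) * H z by exact: pgf_chord.
have [mu0 mu_1] := andP mu1_01.
have mu01 : 0 <= mu1 <= 1 by rewrite !ltW.
set sigma : probability R R := distribution P (C [::]).
have [C01 _ _ Claw] := C_sol.
have sm k : moment sigma k = moment_step H (moment sigma) k.
  exact: (tree_solution_moments k N_iid C_sol).
have s01 : prob01 sigma.
  rewrite /prob01 /= -[LHS]/(P (C [::] @^-1` _)) (_ : _ @^-1` _ = setT) ?probability_setT//.
  by rewrite -subTset => w _; rewrite /preimage /= in_itv/=; exact: C01.
have s0 : moment sigma 0 = 1 by exact: moment0.
have s1 : moment sigma 1 = mu1.
  apply: (root_unique Hnd mu1_01 mu1_root); first exact: moment01.
  by rewrite {2}sm moment_step1 s0 H1; ring.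
have C_mean u : mean P (C u) = mu1.
  rewrite -s1 (moment_distribution 1 (C01 u) (Claw u [::])).
  by apply: eq_mean => w; rewrite expr1.
have [b /andP[b1 b2] b3] := exists_subfixed mu1_01 mu1_root r0 Hleft.
have trE n e : mean P (fun w => truncated N mu1 n [::] w ^+ e) =
    truncated_moment N0 mu1 n e.
  have sT : sigma_family [set v : vertex | (size v < 0)%N]
      (fun v => N v : Omega -> enat) setT by exact: sigma_familyT.
  have := mean_truncated N_iid mu01 n (m := 0%N) (S := [:: ([::], e)]) _ isT sT.
  rewrite big_seq1 indicT mean_cst mul1r => <-; last first.
    by move=> p; rewrite inE => /eqP ->.
  by apply: eq_mean => w; rewrite big_seq1 mul1r.
have tm n : [/\ truncated_moment N0 mu1 n 0 = 1, truncated_moment N0 mu1 n 1 = mu1 &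
    truncated_moment N0 mu1 n 2 <= b].
  elim: n => [|n [t0 t1 t2]]; first by rewrite /truncated_moment /= expr0 expr1.
  rewrite /truncated_moment /= -/(truncated_moment N0 mu1 n) -/H.
  rewrite moment_step0 moment_step1 moment_step2 t0 t1 H1; split=> //.
    by move: mu1_root; rewrite -/H; lra.
  have b_1 : b <= 1 by rewrite ltW// (lt_trans b2).
  have tge0 : 0 <= truncated_moment N0 mu1 n 2.
    by rewrite -trE; apply: mean_ge0 => w; exact: sqr_ge0.
  by have := Hnd _ _ tge0 t2 b_1; move: mu1_root b3; rewrite -/H; lra.
have tb n : mean P (fun w => truncated N mu1 n [::] w ^+ 2) <= b.
  by rewrite trE; case: (tm n).
(* Endogeny enters only here: it rules out the fixed point mu1 of the second-moment map and leaves
   the attracting one. *)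
have s2 : moment sigma 2 < mu1.
  have := moment_le sigma (isT : (1 <= 2)%N); rewrite s1 le_eqVlt => /predU1P[s2|//].
  have s2C : mean P (fun w => C [::] w ^+ 2) = mu1.
    by rewrite -s2 (moment_distribution 2 (C01 [::]) (Claw [::] [::])).
  have := endogenous_second_moment C_sol C_endo mu01 C_mean tb s2C.
  by rewrite leNgt b2.
apply/seteqP; split => nu /=.
- move=> [nu01 nucvg].
  pose M n k := moment (iter n (rde_map N0) nu) k.
  have Mrec n k : M n.+1 k = moment_step H (M n) k by exact: moment_iter_rde_map.
  have M0 n : M n 0%N = 1 by apply: moment0; exact: iter_rde_map.
  have Mc k : M n k @[n --> \oo] --> moment sigma k.
    by apply: nucvg; apply: continuous_within01 => x; exact: exprn_continuous.
  have nu1 : mean01 nu = mu1.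
    apply: (repelling H01 H0 H1 Hc mu1_01 mu1_root r0 Hslope (m := fun n => M n 1%N)).
    + by move=> n; exact: moment01.
    + by move=> n; rewrite Mrec moment_step1 M0 H1.
    + by rewrite -s1; exact: Mc.
  split=> //; split=> // nud.
  (* Started from delta, the iterates keep second moment mu1 for ever, while that of the supposed
     limit is smaller. *)
  have M12 n : M n 1%N = mu1 /\ M n 2%N = mu1.
    elim: n => [|n [h1 h2]].
      split; first exact: nu1.
      rewrite /M /= /moment integral_unit (eq_mean_measure _ nud) -integral_unit.
      by rewrite -delta_mean -(two_point_moment 1 delta_supp).
    rewrite !Mrec moment_step1 moment_step2 M0 H1 h1 h2.
    by split; move: mu1_root; rewrite -/H; lra.
  have : M n 2%N @[n --> \oo] --> mu1.
    by under eq_fun do rewrite (M12 _).2; exact: cvg_cst.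
  move=> /(cvg_unique (@norm_hausdorff _ R))/(_ (Mc 2%N)) e.
  by move: s2; rewrite -e ltxx.
- move=> [nu01 [nu1 nud]]; split=> //; apply: weak_cvg_moments.
  pose M n k := moment (iter n (rde_map N0) nu) k.
  have Mrec n k : M n.+1 k = moment_step H (M n) k by exact: moment_iter_rde_map.
  have M0 n : M n 0%N = 1 by apply: moment0; exact: iter_rde_map.
  have M1 n : M n 1%N = mu1.
    elim: n => [|n h]; first exact: nu1.
    by rewrite Mrec moment_step1 M0 H1 h; move: mu1_root; rewrite -/H; lra.
  (* Equality would force nu to be carried by {0, 1} with mean mu1, that is, to be delta. *)
  have nu2 : M 0%N 2%N < mu1.
    have := moment_le nu (isT : (1 <= 2)%N).
    rewrite (M1 0%N : moment nu 1 = mu1) le_eqVlt => /predU1P[nu2|//].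
    exfalso; apply: nud; apply: eq_two_point_law => //; first by rewrite nu1.
    by rewrite nu2 (M1 0%N : moment nu 1 = mu1).
  have s2fix : moment sigma 2 = 2 * mu1 - 1 + H (moment sigma 2).
    by rewrite {1}sm moment_step2 s0 s1 H1; move: mu1_root; rewrite -/H; lra.
  have [s2ge0 _] := andP (moment01 sigma 2).
  have M2 : M n 2%N @[n --> \oo] --> moment sigma 2.
    apply: (second_moment_cvg Hnd Hc mu1_01 mu1_root s2ge0 s2 s2fix) => //.
      by move=> n; exact: moment01.
    by move=> n; rewrite Mrec moment_step2 M0 M1 H1; move: mu1_root; rewrite -/H; lra.
  have [y [L [sy L01 lip]]] := lipschitz_near Hnd Hc mu1_01 mu1_root s2ge0 s2 s2fix.
  apply: (moments_cvg L01 lip Mrec sm) => //.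
  + by move=> n k; case/andP: (moment01 (iter n (rde_map N0) nu) k).
  + by move=> k; case/andP: (moment01 sigma k).
  + by move=> n k k2; exact: moment_le.
  + by move=> k k2; exact: moment_le.
  + by move=> n; rewrite s0.
  + by move=> n; rewrite s1.
Qed.
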